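(* Under the standing setting, the following statements are equivalent. (i) $X$ a.s. has no negative jumps (i.e. a.s. $X_t-X_{t-}\ge 0$ for all $t\in(0,\zeta)$), and condition (P) holds. (ii) The running infimum process $\underline{X}$ is a.s. continuous (on $[0,\zeta)$), and condition (P) holds. (iii) For each $q\in[0,\infty)$ there exists a nonincreasing map $\Phi_q:I\to(0,\infty)$, which is strictly decreasing and right-continuous if $q>0$, such that $$\mathbb{P}_x[e^{-qT_\ell^-};T_\ell^-<\zeta]=\frac{\Phi_q(x)}{\Phi_q(\ell)}\quad\text{for all }\ell\le x\text{ from }I. \tag{S}$$ (iv) For some $q\in(0,\infty)$ there exists a strictly decreasing map $\Phi_q:I\to(0,\infty)$ such that (S) holds. (v) $X$ is continuous at the minimum and condition (P) holds. Moreover, the statements (i), (ii) and (v) remain equivalent to one another if condition (P) is deleted from each of them.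
   Context: Standing setting: $I\subset\mathbb{R}$ is an interval unbounded above. $X=(X_t)_{t\in[0,\zeta)}$ is a process under complete probability measures $(\mathbb{P}_x)_{x\in I}$ (whose domains all contain $\mathcal{F}_\infty$), adapted to a filtration $\mathcal{F}=(\mathcal{F}_t)_{t\ge0}$ that is complete in the sense that each $\mathcal{F}_t$ contains every set differing from an event of $\mathcal{F}_t$ by a set that is $\mathbb{P}_x$-null for all $x\in I$. The lifetime $\zeta$ is an $\mathcal{F}$-stopping time with $\zeta>0$ a.s., and $X_t:=\infty$ (cemetery) for $t\ge\zeta$. ''a.s.'' means $\mathbb{P}_x$-a.s. for every $x\in I$, and ''negligible'' means $\mathbb{P}_x$-null for every $x$. Assumptions: paths of $X$ are càdlàg in $I$ on $[0,\zeta)$; on $\{0<\zeta<\infty\}$ the limit $X_{\zeta-}$ exists in $I\cup\{\infty\}$ a.s. (set $X_{\zeta-}:=\infty$ when it does not exist); $x\mapsto\mathbb{P}_x(t<\zeta,X_t\in A)$ is universally measurable for Borel $A\subset I$; normality: $X_0=x$ $\mathbb{P}_x$-a.s.; strong Markov: for every $\mathcal{F}$-stopping time $S$ and measurable $H\ge0$, $\mathbb{P}_x[H(X_{S+\cdot})\mid\mathcal{F}_S]=\mathbb{P}_{X_S}[H(X)]$ $\mathbb{P}_x$-a.s. on $\{S<\zeta\}$; quasi left-continuity: if $\mathcal{F}$-stopping times $T_n$ increase a.s. to $T$ then $X_{T_n}\to X_T$ a.s. on $\{T<\zeta\}$; non-announceability: for every a.s. nondecreasing sequence $(T_n)$ of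 $\mathcal{F}$-stopping times, the event $\{T_n<\zeta\ \forall n\}\cap\{\lim_n T_n=\zeta\}\cap\{\zeta<\infty,X_{\zeta-}<\infty\}$ is negligible. Notation: $\mathbb{P}_x[Y;A]:=\mathbb{E}_x[Y\mathbf{1}_A]$; for $\ell\in I$, $T_\ell^-:=\inf\{t\in[0,\zeta):X_t\le\ell\}$ ($\inf\emptyset=\infty$); $\underline{X}_t:=\inf_{s\in[0,t]}X_s$. Condition (P): $\mathbb{P}_x(T_\ell^-<\zeta)>0$ for all $\ell\le x$ from $I$. Definition: $X$ is continuous at the minimum if $X_{T_a^-}=a$ $\mathbb{P}_x$-a.s. on $\{T_a^-<\zeta\}$ for all $a\le x$ from $I$ with $a>\inf I$. *)

(* Defs.v *)
From HB Require Import structures.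
From mathcomp Require Import all_boot all_order all_algebra.
From mathcomp Require Import all_classical all_reals all_analysis measurable_realfun.
Set Implicit Arguments. Unset Strict Implicit. Unset Printing Implicit Defensive.
Import Order.TTheory GRing.Theory Num.Theory.
Import numFieldNormedType.Exports.
Local Open Scope classical_set_scope.
Local Open Scope ring_scope.

Section Setting.
Context {d : measure_display} {Omega : measurableType d} {R : realType}.

(* The family (P_x)_{x in I}; only x in I is ever used. *)
Variable P : R -> probability Omega R.
Variable I : set R.

Definition negl (N : set Omega) : Prop :=
  forall x, I x -> (P x).-negligible N.

Definition as_ (E : set Omega) : Prop := negl (~` E).

(* P_x[Y; A] for Y >= 0 (lower integral, which coincides with the integral
   w.r.t. the completion of P_x for completion-measurable Y) *)
Definition Ex (x : R) (A : set Omega) (Y : Omega -> \bar R) : \bar R :=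
  (\int[P x]_(w in A) Y w)%E.

Definition Pr (x : R) (A : set Omega) : \bar R := Ex x A (fun=> 1%E).

(* Filtration (indexed by t >= 0), lifetime, process *)
Variable F : R -> set (set Omega).
Variable zeta : Omega -> \bar R.
Variable X : R -> Omega -> R.

(* the path of X with the cemetery +oo after the lifetime:
   Xc t w = X_t(w) for t < zeta(w), and = +oo (cemetery) for t >= zeta(w) *)
Definition Xc (t : R) (w : Omega) : \bar R :=
  if (t%:E < zeta w)%E then (X t w)%:E else +oo%E.

Definition F_infty : set (set Omega) :=
  smallest (sigma_algebra setT) (\bigcup_(t in [set t : R | 0 <= t]) F t).

Definition stopping_time (S : Omega -> \bar R) : Prop :=
  (forall w, (0 <= S w)%E) /\
  forall t, 0 <= t -> F t [set w | (S w <= t%:E)%E].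

Definition F_at (S : Omega -> \bar R) : set (set Omega) :=
  [set A | F_infty A /\
     forall t, 0 <= t -> F t (A `&` [set w | (S w <= t%:E)%E])].

(* sigma-algebra on the path space (I u {oo})^[0,oo) generated by the
   coordinate maps w |-> w t, t >= 0 (paths are encoded as R -> \bar R) *)
Definition path_sigma : set (set (R -> \bar R)) :=
  smallest (sigma_algebra setT)
    [set A | exists (t : R) (B : set \bar R),
       [/\ 0 <= t, measurable B & A = [set w : R -> \bar R | B (w t)]]].

Definition path_measurable (H : (R -> \bar R) -> \bar R) : Prop :=
  forall B : set \bar R, measurable B -> path_sigma (H @^-1` B).

Definition univ_measurable_on (f : R -> \bar R) : Prop :=
  forall (mu : probability R R) (B : set \bar R), measurable B ->
    exists A1 A2 : set R, [/\ measurable A1, measurable A2,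
      A1 `<=` I `&` f @^-1` B, I `&` f @^-1` B `<=` A2 & mu (A2 `\` A1) = 0%E].

Definition has_left_lim_in (w : Omega) (z l : R) : Prop :=
  I l /\ (fun s => X s w) @ z^'- --> l.

Record standing_setting : Prop := {
  I_interval : is_interval I;
  I_unbounded_above : forall M, exists x, I x /\ M < x;
  F_sigma : forall t, 0 <= t -> sigma_algebra setT (F t);
  F_sub_measurable : forall t, 0 <= t -> F t `<=` measurable;
  F_nondecreasing : forall s t, 0 <= s -> s <= t -> F s `<=` F t;
  F_complete : forall t (A B : set Omega), 0 <= t -> F t A ->
    negl ((A `\` B) `|` (B `\` A)) -> F t B;
  X_adapted : forall t (B : set \bar R), 0 <= t -> measurable B ->
    F t [set w | B (Xc t w)];
  zeta_stopping : stopping_time zeta;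
  zeta_pos : as_ [set w | (0 < zeta w)%E];
  X_in_I : forall w t, 0 <= t -> (t%:E < zeta w)%E -> I (X t w);
  X_right_cont : forall w t, 0 <= t -> (t%:E < zeta w)%E ->
    (fun s => X s w) @ t^'+ --> X t w;
  X_left_lim : forall w t, 0 < t -> (t%:E < zeta w)%E ->
    exists l, has_left_lim_in w t l;
  X_zeta_left_lim : as_ [set w | (0 < zeta w < +oo)%E ->
    (exists l, has_left_lim_in w (fine (zeta w)) l) \/
    ((fun s => X s w) @ (fine (zeta w))^'- --> +oo)];
  X_univ_meas : forall t (A : set R), 0 <= t -> measurable A -> A `<=` I ->
    univ_measurable_on (fun x => P x [set w | (t%:E < zeta w)%E /\ A (X t w)]);
  X_normal : forall x, I x -> (P x).-negligible [set w | Xc 0 w <> x%:E];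
  (* strong Markov property, conditional expectation written out *)
  X_strong_Markov : forall (S : Omega -> \bar R) (H : (R -> \bar R) -> \bar R),
    stopping_time S -> path_measurable H -> (forall p, (0 <= H p)%E) ->
    forall x A, I x -> F_at S A ->
      Ex x (A `&` [set w | (S w < zeta w)%E])
         (fun w => H (fun t => Xc (fine (S w) + t) w)) =
      Ex x (A `&` [set w | (S w < zeta w)%E])
         (fun w => Ex (X (fine (S w)) w) setT (fun v => H (fun t => Xc t v)));
  X_qlc : forall (T : nat -> Omega -> \bar R) (Tinf : Omega -> \bar R),
    (forall n, stopping_time (T n)) -> stopping_time Tinf ->
    as_ [set w | {homo (fun n => T n w) : m n / (m <= n)%N >-> (m <= n)%E} /\
                 (fun n => T n w) @ \oo --> Tinf w] ->
    as_ [set w | (Tinf w < zeta w)%E ->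
                 (fun n => X (fine (T n w)) w) @ \oo --> X (fine (Tinf w)) w];
  X_non_announce : forall T : nat -> Omega -> \bar R,
    (forall n, stopping_time (T n)) ->
    as_ [set w | {homo (fun n => T n w) : m n / (m <= n)%N >-> (m <= n)%E}] ->
    negl [set w | (forall n, (T n w < zeta w)%E) /\
                  (fun n => T n w) @ \oo --> zeta w /\
                  (zeta w < +oo)%E /\
                  exists l, has_left_lim_in w (fine (zeta w)) l]
}.

Definition Tminus (l : R) (w : Omega) : \bar R :=
  ereal_inf [set t%:E | t in [set t : R | 0 <= t /\ (t%:E < zeta w)%E /\ X t w <= l]].

Definition Xinf (t : R) (w : Omega) : R := inf [set X s w | s in `[0, t]].

Definition Xleft (t : R) (w : Omega) : R := lim ((fun s => X s w) @ t^'-).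

Definition condP : Prop :=
  forall x l, I x -> I l -> l <= x -> (0 < Pr x [set w | (Tminus l w < zeta w)%E])%E.

Definition no_negative_jumps : Prop :=
  as_ [set w | forall t, 0 < t -> (t%:E < zeta w)%E -> X t w - Xleft t w >= 0].

Definition inf_continuous : Prop :=
  as_ [set w | {within [set t : R | 0 <= t /\ (t%:E < zeta w)%E],
                 continuous (fun t => Xinf t w)}].

Definition identity_S (q : R) (Phi : R -> R) : Prop :=
  forall l x, I l -> I x -> l <= x ->
    Ex x [set w | (Tminus l w < zeta w)%E] (fun w => (expR (- q * fine (Tminus l w)))%:E)
    = (Phi x / Phi l)%:E.

Definition cont_at_min : Prop :=
  forall a x, I a -> I x -> a <= x -> (exists b, I b /\ b < a) ->
    (P x).-negligible [set w | (Tminus a w < zeta w)%E /\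
                               X (fine (Tminus a w)) w <> a].

Definition statement_iii : Prop :=
  forall q : R, 0 <= q -> exists Phi : R -> R,
    [/\ forall x, I x -> 0 < Phi x,
        forall x y, I x -> I y -> x <= y -> Phi y <= Phi x,
        0 < q -> (forall x y, I x -> I y -> x < y -> Phi y < Phi x) /\
                 (forall x, I x -> Phi @ x^'+ --> Phi x)
      & identity_S q Phi].

Definition statement_iv : Prop :=
  exists q : R, 0 < q /\ exists Phi : R -> R,
    [/\ forall x, I x -> 0 < Phi x,
        forall x y, I x -> I y -> x < y -> Phi y < Phi x
      & identity_S q Phi].

End Setting.

(* Main.v *)
Require Import Defs.
From HB Require Import structures.
From mathcomp Require Import all_boot all_order all_algebra.
From mathcomp Require Import all_classical all_reals all_analysis measurable_realfun.
From mathcomp Require Import lra.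
Set Implicit Arguments. Unset Strict Implicit. Unset Printing Implicit Defensive.
Import Order.TTheory GRing.Theory Num.Theory.
Import numFieldNormedType.Exports.
Local Open Scope classical_set_scope.
Local Open Scope ring_scope.

(** Between two levels [l <= a] the process restarted at [T_a] does not depend on the past,
    so if [X_{T_a} = a] then [E_x exp (- q T_l)] is the product of [E_x exp (- q T_a)] and
    [E_a exp (- q T_l)], and a multiplicative two-parameter function is a quotient
    [Phi x / Phi l].  Conversely, a downward overshoot at [T_a] increases
    [E_{X_{T_a}} exp (- q T_l)] strictly, so the product formula forbids it.  A negative jump
    of [X] at [t] is a jump of the running infimum of the path restarted at a rational time
    shortly before [t], hence by the Markov property it is excluded by continuity at the
    minimum.  The filtration need not be right-continuous; [T_l] is a stopping time because it
    is a.s. the limit of the times at which the running infimum reaches [l + 1/n], by quasi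
    left-continuity before the lifetime and by non-announceability at the lifetime. *)

(** Two features of the strong Markov property shape the argument. It localises on events of
    [F_at S] and carries no weight depending on [S], so the factor [exp (- q T_a)] cannot be split
    off at once; the property is applied on the events [u < T_a <= v], and a fine grid of values of
    [T_a] restores the weight. Moreover it only admits functionals measurable for the coordinates,
    whereas [Tminus] is an infimum over uncountably many times. Right continuity of the paths makes
    rational times sufficient up to a null set, so [exp (- q T_l)] is replaced by a functional of
    countably many coordinates that agrees with it almost surely. The integrands produced in this
    way (this functional after a random shift, and the starting-point function evaluated at
    [X_{T_a}]) are handled as lower integrals, which are monotone and insensitive to null sets. *)

Lemma near_at_right_itv (R : realType) (t : R) (Q : R -> Prop) :
  (\forall s \near t^'+, Q s) ->
  exists2 e, 0 < e & forall s, t < s -> s < t + e -> Q s.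
Proof.
move=> [e /= e0 he]; exists e => // s ts ste; apply: he => //=.
by rewrite ltr_distlC; apply/andP; split; lra.
Qed.

Lemma near_at_left_itv (R : realType) (t : R) (Q : R -> Prop) :
  (\forall s \near t^'-, Q s) ->
  exists2 e, 0 < e & forall s, t - e < s -> s < t -> Q s.
Proof.
move=> [e /= e0 he]; exists e => // s ts ste; apply: he => //=.
by rewrite ltr_distlC; apply/andP; split; lra.
Qed.

Lemma lt_ereal_room (R : realType) (t : R) (z : \bar R) : (t%:E < z)%E ->
  exists2 e, 0 < e & forall s, s < t + e -> (s%:E < z)%E.
Proof.
case: z => [z| |//]; last by exists 1 => // s _; rewrite ltry.
rewrite lte_fin => tz; exists (z - t); first by lra.
by move=> s hs; rewrite lte_fin; lra.
Qed.

(** * Level passage and running infimum along a single path *)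

Section Paths.
Context {d : measure_display} {Omega : measurableType d} {R : realType}.
Variables (I : set R) (P : R -> probability Omega R) (F : R -> set (set Omega)).
Variables (zeta : Omega -> \bar R) (X : R -> Omega -> R).
Hypothesis ss : standing_setting P I F zeta X.

Local Notation T := (Tminus zeta X).

Lemma right_lt (w : Omega) (t c : R) : 0 <= t -> (t%:E < zeta w)%E -> X t w < c ->
  exists2 e, 0 < e & forall s, t <= s -> s < t + e -> (s%:E < zeta w)%E /\ X s w < c.
Proof.
move=> t0 tz Xc; have [e e0 he] := lt_ereal_room tz.
have [e' e'0 he'] := near_at_right_itv (cvgr_lt _ (X_right_cont ss t0 tz) _ Xc).
exists (Num.min e e'); first by rewrite lt_min e0.
move=> s ts; rewrite -ltrBlDl lt_min => /andP[h1 h2].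
split; first by apply: he; lra.
by move: ts; rewrite le_eqVlt => /predU1P[<-//|ts]; apply: he' => //; lra.
Qed.

Lemma right_gt (w : Omega) (t c : R) : 0 <= t -> (t%:E < zeta w)%E -> c < X t w ->
  exists2 e, 0 < e & forall s, t <= s -> s < t + e -> (s%:E < zeta w)%E /\ c < X s w.
Proof.
move=> t0 tz Xc; have [e e0 he] := lt_ereal_room tz.
have [e' e'0 he'] := near_at_right_itv (cvgr_gt _ (X_right_cont ss t0 tz) _ Xc).
exists (Num.min e e'); first by rewrite lt_min e0.
move=> s ts; rewrite -ltrBlDl lt_min => /andP[h1 h2].
split; first by apply: he; lra.
by move: ts; rewrite le_eqVlt => /predU1P[<-//|ts]; apply: he' => //; lra.
Qed.

Lemma Tminus_ge0 l w : (0 <= T l w)%E.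
Proof. by apply: le_ereal_inf_tmp => _ [t [t0 _] <-]; rewrite lee_fin. Qed.

Lemma Tminus_le l w t : 0 <= t -> (t%:E < zeta w)%E -> X t w <= l -> (T l w <= t%:E)%E.
Proof. by move=> t0 tz Xl; apply: ereal_inf_lbound; exists t. Qed.

Lemma Tminus_gt l w s : 0 <= s -> (s%:E < zeta w)%E -> (s%:E < T l w)%E -> l < X s w.
Proof. by move=> s0 sz sT; rewrite ltNge; apply/negP => /(Tminus_le s0 sz); rewrite leNgt sT. Qed.

(** By right continuity: a value above [l] at the infimum of the passage set would persist on an
    interval to its right, and the infimum would be larger. *)
Lemma Tminus_attained l w : (T l w < zeta w)%E ->
  [/\ 0 <= fine (T l w), T l w = (fine (T l w))%:E & X (fine (T l w)) w <= l].
Proof.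
move=> Tz; have T0 := Tminus_ge0 l w.
have Tfin : T l w = (fine (T l w))%:E.
  rewrite fineK// ge0_fin_numE//; apply: lt_le_trans Tz _; exact: leey.
have t0 : 0 <= fine (T l w) by rewrite fine_ge0.
split=> //; rewrite leNgt; apply/negP => lX.
move: Tz; rewrite {1}Tfin => Tz.
have [e e0 he] := right_gt t0 Tz lX.
have : (T l w < (fine (T l w) + e)%:E)%E by rewrite Tfin lte_fin /=; lra.
move=> /ereal_inf_lt[_ [s [s0 [sz Xs]] <-]]; rewrite lte_fin => hs.
have Ts : fine (T l w) <= s by rewrite -lee_fin -Tfin; exact: Tminus_le.
by have [_] := he s Ts hs; rewrite ltNge Xs.
Qed.

Lemma Tminus_lt_zeta l w t : 0 <= t -> (t%:E < zeta w)%E -> X t w <= l -> (T l w < zeta w)%E.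
Proof. by move=> t0 tz Xt; exact: le_lt_trans (Tminus_le t0 tz Xt) tz. Qed.

(** The times entering the infimum lie before [zeta], so [Tminus] never takes a finite value at or
    after the lifetime. *)
Lemma Tminus_ge_zeta l w : (zeta w <= T l w)%E -> T l w = +oo%E.
Proof.
move=> zT; rewrite /Tminus.
suff -> : [set t%:E | t in [set t : R | 0 <= t /\ (t%:E < zeta w)%E /\ X t w <= l]] = set0.
  exact: ereal_inf0.
rewrite -subset0 => _ [t [t0 [tz Xt]] <-].
by have := Tminus_lt_zeta t0 tz Xt; rewrite ltNge zT.
Qed.

(* [low c t w] says that [inf_{s <= t, s < zeta} X_s <= c]; the infimum over an
   interval in which the path has left limits need not be attained. *)
Definition low c t w := forall e, 0 < e ->
  exists s, [/\ 0 <= s, s <= t, (s%:E < zeta w)%E & X s w < c + e].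

(** The time at which the running infimum reaches [c]. It may precede [Tminus c], since a left limit
    equal to [c] counts; in exchange the event [Sinf c <= t] is decided by the path up to [t], which
    makes it a stopping time without right-continuity of the filtration. *)
Definition Sinf c w : \bar R := ereal_inf [set t%:E | t in [set t | 0 <= t /\ low c t w]].

Lemma Sinf_ge0 c w : (0 <= Sinf c w)%E.
Proof. by apply: le_ereal_inf_tmp => _ [t [t0 _] <-]; rewrite lee_fin. Qed.

Lemma low_mono c t t' w : t <= t' -> low c t w -> low c t' w.
Proof. by move=> tt' h e /h[s [s0 st sz Xs]]; exists s; split=> //; lra. Qed.

Lemma low_mono_level c c' t w : c <= c' -> low c t w -> low c' t w.
Proof. by move=> tt' h e /h[s [s0 st sz Xs]]; exists s; split=> //; lra. Qed.

(** The set of times satisfying [low c] is closed from the right. If [low] failed at [t < zeta] with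
    tolerance [e], then [X_t >= c + e], and right continuity would keep the path above [c + e/2] for
    a while after [t]. Past [zeta] no new times enter [low]. *)
Lemma Sinf_leP c w t : 0 <= t -> (Sinf c w <= t%:E)%E <-> low c t w.
Proof.
move=> t0; split; last first.
  by move=> h; apply: ereal_inf_lbound; exists t.
move=> St e e0.
have hlow t' : t < t' -> low c t' w.
  move=> tt'; have : (Sinf c w < t'%:E)%E by apply: le_lt_trans St _; rewrite lte_fin.
  move=> /ereal_inf_lt[_ [s [s0 hs] <-]]; rewrite lte_fin => /ltW st'.
  exact: low_mono hs.
have [zt|tz] := leP (zeta w) t%:E.
  have [] := hlow (t + 1) _ e e0; first lra.
  move=> s [s0 _ sz Xs]; exists s; split=> //.
  by rewrite -lee_fin; apply: ltW; apply: lt_le_trans zt.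
apply: contrapT => hn.
have Xt : c + e <= X t w.
  by rewrite leNgt; apply/negP => h; apply: hn; exists t; split.
have Xt' : c + e / 2 < X t w by lra.
have [r r0 hr] := right_gt t0 tz Xt'.
have [||s [s0 st' sz Xs]] := hlow (t + r / 2) _ (e / 2); [lra|lra|].
have [ts|st] := leP t s.
  have [||_] := hr s; [lra|lra|].
  by rewrite ltNge => /negP; apply; lra.
by apply: hn; exists s; split=> //; lra.
Qed.

Lemma Sinf_le_Tminus c w : (Sinf c w <= T c w)%E.
Proof.
apply: le_ereal_inf_tmp => _ [t [t0 [tz Xt]] <-]; apply/Sinf_leP => //.
by move=> e e0; exists t; split=> //; lra.
Qed.

Lemma Sinf_level c c' w : c <= c' -> (Sinf c' w <= Sinf c w)%E.
Proof.
move=> cc'; apply: le_ereal_inf_tmp => _ [t [t0 h] <-].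
by apply/Sinf_leP => //; apply: low_mono_level h.
Qed.

(** Only times before [zeta] are witnesses, so [low] at any time gives [low] at [zeta]. Unlike
    [Tminus], [Sinf] can equal a finite [zeta]. *)
Lemma Sinf_gt_zeta c w : (zeta w < Sinf c w)%E -> Sinf c w = +oo%E.
Proof.
have [z0|z0] := leP 0%E (zeta w); last first.
  move=> _; rewrite /Sinf.
  suff -> : [set t%:E | t in [set t : R | 0 <= t /\ low c t w]] = set0.
    exact: ereal_inf0.
  rewrite -subset0 => _ [t [t0 /(_ 1 ltr01)[s [s0 _ sz _]]] <-].
  by have := lt_trans sz z0; rewrite lte_fin ltNge s0.
move=> zS; apply/eqP; rewrite -leye_eq; apply: le_ereal_inf_tmp => _ [t [t0 h] <-].
have zfin : zeta w \is a fin_num.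
  by rewrite ge0_fin_numE//; apply: lt_le_trans zS _; exact: leey.
suff : (Sinf c w <= (fine (zeta w))%:E)%E by rewrite fineK// leNgt zS.
apply/Sinf_leP; first by rewrite fine_ge0.
move=> e /h[s [s0 _ sz Xs]]; exists s; split=> //.
by rewrite -lee_fin fineK// ltW.
Qed.

(** Compactness of [[0, t]]: right continuity bounds the path below to the right of each point and
    the left limit does so to the left. The real-valued [inf] in [Xinf] is a greatest lower bound
    only once this is known. *)
Lemma path_lbounded w t : (t%:E < zeta w)%E ->
  exists M, forall s, 0 <= s -> s <= t -> M <= X s w.
Proof.
move=> tz.
have /compact_near_coveringP := @segment_compact R 0 t.
move=> /(_ R (pinfty_nbhs R) (fun M s => 0 <= s -> s <= t -> - M <= X s w)).
move=> []; last first.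
  move=> M0 [_ hM]; exists (- (M0 + 1)) => s s0 st.
  by apply: (hM (M0 + 1)) => //=; [lra|rewrite in_itv /= s0].
move=> s /=; rewrite in_itv /= => /andP[s0 st].
have sz : (s%:E < zeta w)%E by apply: le_lt_trans tz; rewrite lee_fin.
have XX : X s w - 1 < X s w by lra.
have [e e0 he] := right_gt s0 sz XX.
have [e' [M [e'0 hM]]] : exists e' M, 0 < e' /\
    forall u, s - e' < u -> u < s -> 0 <= u -> M <= X u w.
  move: s0; rewrite le_eqVlt => /predU1P[<-|s0].
    by exists 1, 0; split=> // u _ u0; rewrite leNgt u0.
  have [L [_ hL]] := X_left_lim ss s0 sz.
  have LL : L - 1 < L by lra.
  have [e' e'0 he'] := near_at_left_itv (cvgr_gt _ hL _ LL).
  by exists e', (L - 1); split=> // u su us _; apply/ltW/he'.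
exists ([set u | `|s - u| < Num.min e e'], [set K | Num.max (- (X s w - 1)) (- M) < K]).
  split=> /=.
    exists (Num.min e e') => //=; first by rewrite lt_min e0.
    exists (Num.max (- (X s w - 1)) (- M)); split=> //; exact: num_real.
move=> [u K] /= []; rewrite lt_min => /andP[]; rewrite !ltr_distlC gt_max.
move=> /andP[a1 a2] /andP[a3 a4] /andP[K1 K2] u0 ut.
have [su|us] := leP s u.
  have [_] := he u su a2; lra.
by have := hM u a3 us u0; lra.
Qed.

Lemma Xinf_le w t s : (t%:E < zeta w)%E -> 0 <= s -> s <= t -> Xinf X t w <= X s w.
Proof.
move=> tz s0 st; have [M hM] := path_lbounded tz.
apply: ge_inf; last by exists s => //=; rewrite in_itv /= s0.
by exists M => _ /= [u + <-]; rewrite in_itv /= => /andP[? ?]; apply: hM.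
Qed.

Lemma Xinf_ge w t c : 0 <= t -> (forall s, 0 <= s -> s <= t -> c <= X s w) ->
  c <= Xinf X t w.
Proof.
move=> t0 h; apply: lb_le_inf.
  by exists (X 0 w), 0 => //=; rewrite in_itv /= lexx.
by move=> _ /= [u + <-]; rewrite in_itv /= => /andP[? ?]; apply: h.
Qed.

End Paths.

Lemma invSn_lt (R : realType) (e : R) : 0 < e -> exists n : nat, n.+1%:R^-1 < e.
Proof.
move=> e0; have [n _ /(_ n (leqnn n))] := near_infty_natSinv_lt (PosNum e0).
by move=> /= h; exists n.
Qed.

Lemma invSn_gt0 (R : realType) n : 0 < n.+1%:R^-1 :> R.
Proof. by rewrite invr_gt0 ltr0n. Qed.

(** * Passage times are stopping times *)

Section StoppingTimes.
Context {d : measure_display} {Omega : measurableType d} {R : realType}.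
Variables (I : set R) (P : R -> probability Omega R) (F : R -> set (set Omega)).
Variables (zeta : Omega -> \bar R) (X : R -> Omega -> R).
Hypothesis ss : standing_setting P I F zeta X.

Local Notation T := (Tminus zeta X).
Local Notation Sinf := (Sinf zeta X).
Local Notation low := (low zeta X).

Lemma negl_subset (A B : set Omega) : A `<=` B -> negl P I B -> negl P I A.
Proof. by move=> AB nB x Ix; apply: negligibleS AB (nB x Ix). Qed.

Lemma negl_setU (A B : set Omega) : negl P I A -> negl P I B -> negl P I (A `|` B).
Proof. by move=> nA nB x Ix; apply: negligibleU; [exact: nA|exact: nB]. Qed.

Lemma negl_set0 : negl P I set0.
Proof. by move=> x _; exact: negligible_set0. Qed.

Lemma as_all (E : set Omega) : (forall w, E w) -> as_ P I E.
Proof. by move=> h; apply: negl_subset negl_set0 => w; apply; exact: h. Qed.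

Lemma F_setT t : 0 <= t -> F t setT.
Proof.
move=> t0; have [s0 sD _] := F_sigma ss t0.
by rewrite -(setD0 setT); exact: sD.
Qed.

Lemma F_setC t A : 0 <= t -> F t A -> F t (~` A).
Proof. by move=> t0 FA; have [_ sD _] := F_sigma ss t0; rewrite -setTD; exact: sD. Qed.

Lemma F_bigcup t (A : nat -> set Omega) : 0 <= t -> (forall n, F t (A n)) -> F t (\bigcup_n A n).
Proof. by move=> t0 FA; have [_ _] := F_sigma ss t0; exact. Qed.

Lemma F_bigcap t (A : nat -> set Omega) : 0 <= t -> (forall n, F t (A n)) -> F t (\bigcap_n A n).
Proof.
move=> t0 FA; rewrite -[X in F t X]setCK setC_bigcap; apply: F_setC => //.
by apply: F_bigcup => // n; exact: F_setC.
Qed.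

Lemma F_setI t A B : 0 <= t -> F t A -> F t B -> F t (A `&` B).
Proof.
move=> t0 FA FB; rewrite -[X in F t X]setCK setCI; apply: F_setC => //.
rewrite -bigcup2E; apply: F_bigcup => // -[|[|n]] /=; try exact: F_setC.
by have [] := F_sigma ss t0.
Qed.

Definition dense_time (t : R) n : R :=
  if unpickle n is Some q then
    let s := ratr (q : rat) in if 0 <= s <= t then s else t else t.

Lemma dense_time_itv t n : 0 <= t -> 0 <= dense_time t n <= t.
Proof.
move=> t0; rewrite /dense_time; case: unpickle => [q|]; last by rewrite t0 lexx.
by case: ifP => //; rewrite t0 lexx.
Qed.

Lemma lowE c t w : 0 <= t ->
  low c t w <-> forall k, exists n, (Xc zeta X (dense_time t n) w < (c + k.+1%:R^-1)%:E)%E.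
Proof.
move=> t0; split=> [h k|h e e0].
  have [s [s0 st sz Xs]] := h _ (invSn_gt0 R k).
  move: st; rewrite le_eqVlt => /predU1P[st|st].
    suff [n hn] : exists n, dense_time t n = t.
      by exists n; rewrite hn /Xc -st sz lte_fin.
    (* The rational [-1] lies outside [[0, t]], so its code is sent to the default value [t]. *)
    exists (pickle (-1 : rat)); rewrite /dense_time pickleK rmorphN1.
    by rewrite lerNr oppr0 ler10.
  have [e e0 he] := right_lt ss s0 sz Xs.
  have hlt : s < Num.min t (s + e) by rewrite lt_min st; lra.
  have [q] := rat_in_itvoo hlt; rewrite in_itv /= lt_min => /andP[q1 /andP[q2 q3]].
  exists (pickle q); rewrite /dense_time pickleK.
  have -> : (0 <= ratr q :> R) && (ratr q <= t) by rewrite (le_trans s0 (ltW q1)) ltW.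
  by have [||qz Xq] := he (ratr q); [lra|lra|]; rewrite /Xc qz lte_fin.
have [k hk] := invSn_lt e0; have [n] := h k.
rewrite /Xc; case: ifP => // sz; rewrite lte_fin => Xs.
have /andP[a b] := dense_time_itv n t0.
exists (dense_time t n); split=> //; apply: lt_trans Xs _; by rewrite ltrD2l.
Qed.

Lemma measurable_ereal_lt (c : R) : measurable [set y : \bar R | (y < c%:E)%E].
Proof.
have -> : [set y : \bar R | (y < c%:E)%E] = [set` Interval -oo%O (BLeft c%:E)].
  by apply/seteqP; split=> y /=; rewrite in_itv.
exact: emeasurable_itv.
Qed.

Lemma low_F c t : 0 <= t -> F t [set w | low c t w].
Proof.
move=> t0.
have -> : [set w | low c t w] = \bigcap_k \bigcup_n
    [set w | (Xc zeta X (dense_time t n) w < (c + k.+1%:R^-1)%:E)%E].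
  apply/seteqP; split=> w /=.
    by move=> /(lowE c w t0) h k _; have [n hn] := h k; exists n.
  by move=> h; apply/(lowE c w t0) => k; have [n _ hn] := h k Logic.I; exists n.
apply: F_bigcap => // k; apply: F_bigcup => // n.
have /andP[s0 st] := dense_time_itv n t0.
apply: (F_nondecreasing ss s0 st).
exact: (X_adapted ss s0 (measurable_ereal_lt _)).
Qed.

Lemma Sinf_stopping c : stopping_time F (Sinf c).
Proof.
split=> [w|t t0]; first exact: Sinf_ge0.
rewrite (_ : [set w | _] = [set w | low c t w]); first exact: low_F.
by apply/seteqP; split=> w /=; rewrite (Sinf_leP ss c w t0).
Qed.

(** The times increase as the levels decrease to [l], and at a finite limit [s] the property
    [low (l + 1/(n+1))] holds for all [n], which is [low l]. This holds on every path and supplies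
    the increasing sequence for quasi left-continuity and non-announceability. *)
Lemma Sinf_cvg l w : (fun n => Sinf (l + n.+1%:R^-1) w) @ \oo --> Sinf l w.
Proof.
have homo : {homo (fun n => Sinf (l + n.+1%:R^-1) w) : m n / (m <= n)%N >-> (m <= n)%E}.
  by move=> m n mn; apply: (Sinf_level ss); rewrite lerD2l lef_pV2 ?posrE ?ltr0n// ler_nat.
have := ereal_nondecreasing_cvgn homo.
set s := ereal_sup _; suff -> : s = Sinf l w by [].
apply/eqP; rewrite eq_le; apply/andP; split.
  apply: ge_ereal_sup => _ [n _ <-]; apply: (Sinf_level ss).
  by rewrite lerDl ltW// invSn_gt0.
have hs n : (Sinf (l + n.+1%:R^-1) w <= s)%E by apply: ereal_sup_ubound; exists n.
have s0 : (0 <= s)%E by apply: le_trans (hs 0%N); exact: Sinf_ge0.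
move: s s0 hs => [s| |//] s0 hs; last exact: leey.
apply/(Sinf_leP ss) => // e e0.
have e20 : 0 < e / 2 by lra.
have [n hn] := invSn_lt e20.
have /(Sinf_leP ss) := hs n; rewrite -lee_fin => /(_ s0 (e / 2) e20)[u [u0 us uz Xu]].
exists u; split=> //; move: (n.+1%:R^-1) hn Xu => r hn Xu; lra.
Qed.

Lemma low_retreat l m t e w : l < m -> 0 < e ->
  (forall s, t - e < s -> s < t -> m <= X s w) ->
  ((t%:E < zeta w)%E -> l < X t w) -> low l t w -> low l (t - e) w.
Proof.
move=> lm e0 hl ht h r r0.
have [b [b0 br hb]] : exists b, [/\ 0 < b, b <= r /\ b <= m - l &
    (t%:E < zeta w)%E -> b <= X t w - l].
  have [tz|zt] := boolP (t%:E < zeta w)%E.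
    exists (Num.min r (Num.min (m - l) (X t w - l))).
    rewrite !lt_min r0 !subr_gt0 lm ht// !ge_min !lexx !orbT.
    by split.
  exists (Num.min r (m - l)); rewrite lt_min r0 subr_gt0 lm !ge_min !lexx orbT.
  by split.
have [s [s0 st sz Xs]] := h b b0.
exists s; split=> //; last by lra.
rewrite leNgt; apply/negP => ts.
move: st; rewrite le_eqVlt => /predU1P[st|st].
  by move: sz Xs; rewrite st => /hb; lra.
by have := hl s ts st; lra.
Qed.

Lemma Tminus_Sinf_as l : as_ P I [set w | T l w = Sinf l w].
Proof.
pose Tn n := Sinf (l + n.+1%:R^-1).
have Tn_homo w : {homo (fun n => Tn n w) : m n / (m <= n)%N >-> (m <= n)%E}.
  by move=> m n mn; apply: (Sinf_level ss); rewrite lerD2l lef_pV2 ?posrE ?ltr0n// ler_nat.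
have G1 := X_qlc ss (fun n => Sinf_stopping (l + n.+1%:R^-1)) (Sinf_stopping l)
  (as_all (fun w => conj (Tn_homo w) (@Sinf_cvg l w))).
have G3 := X_non_announce ss (fun n => Sinf_stopping (l + n.+1%:R^-1)) (as_all Tn_homo).
apply: negl_subset (negl_setU G1 (negl_setU (X_zeta_left_lim ss) G3)).
move=> w /= TS; apply: contrapT => /not_orP[/contrapT h1 /not_orP[/contrapT h2 h3]].
apply: TS.
have Tn_lt s n : 0 <= s -> (s%:E < zeta w)%E -> X s w < l + n.+1%:R^-1 -> (Tn n w <= s%:E)%E.
  move=> s0 sz Xs; apply: le_trans (Sinf_le_Tminus ss _ _) _.
  by apply: (Tminus_le s0 sz (ltW Xs)).
have [zS|Sz] := leP (zeta w) (Sinf l w).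
  (* Here [Tminus] is infinite, so a discrepancy requires [Sinf l = zeta < +oo]; in that case the
     [Tn] announce [zeta]. *)
  have zT : (zeta w <= T l w)%E by apply: le_trans zS (Sinf_le_Tminus ss _ _).
  rewrite (Tminus_ge_zeta zT); move: zS; rewrite le_eqVlt => /predU1P[zS|zS]; last first.
    by rewrite (Sinf_gt_zeta ss zS).
  have [zoo|zfin] := eqVneq (zeta w) +oo%E; first by rewrite -zS.
  exfalso; apply: h3.
  have zlt : (zeta w < +oo)%E by rewrite ltey.
  have z0 : (0 <= zeta w)%E by rewrite zS; exact: Sinf_ge0.
  have zE : zeta w = (fine (zeta w))%:E by rewrite fineK// ge0_fin_numE.
  have lowz : low l (fine (zeta w)) w.
    by apply/(Sinf_leP ss); rewrite ?fine_ge0// -zE -zS.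
  have [s0 [s00 _ s0z _]] := lowz 1 ltr01.
  have zpos : (0 < zeta w)%E by apply: le_lt_trans s0z; rewrite lee_fin.
  split.
    move=> n; have [s [s1 _ sz Xs]] := lowz _ (invSn_gt0 R n).
    exact: le_lt_trans (Tn_lt _ _ s1 sz Xs) sz.
  split; first by rewrite [X in _ --> X]zS; exact: Sinf_cvg.
  split=> //.
  have [|//|] := h2; first by rewrite zpos zlt.
  (* If the left limit at [zeta] is infinite, the path exceeds [l + 1] just before [zeta], so
     [low l] held earlier, against [Sinf l = zeta]. *)
  move=> /cvgryPgt /(_ (l + 1)) /near_at_left_itv[e e0 he]; exfalso.
  have lowe : low l (fine (zeta w) - e) w.
    apply: (low_retreat (m := l + 1)) lowz => //; first by lra.
      by move=> s a b; apply/ltW/he.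
    by rewrite -zE ltxx.
  have te0 : 0 <= fine (zeta w) - e by have [s [s1 se _ _]] := lowe 1 ltr01; lra.
  by move/(Sinf_leP ss _ _ te0) : lowe; rewrite -zS {1}zE lee_fin; lra.
have Sfin : Sinf l w = (fine (Sinf l w))%:E.
  rewrite fineK// ge0_fin_numE ?Sinf_ge0//; apply: lt_le_trans Sz _; exact: leey.
set t := fine (Sinf l w) in Sfin.
have t0 : 0 <= t by rewrite fine_ge0// Sinf_ge0.
have lowt : low l t w by apply/(Sinf_leP ss) => //; rewrite Sfin.
have tz : (t%:E < zeta w)%E by rewrite -Sfin.
apply/eqP; rewrite eq_le (Sinf_le_Tminus ss) andbT Sfin.
suff Xt : X t w <= l by exact: Tminus_le.
rewrite leNgt; apply/negP => lX.
(* The inequality is strict because a tolerance at most [X_t - l] excludes [t] as a witness of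
   [low]. Hence [X] along [Tn] tends to the left limit at [t], which quasi left-continuity then
   identifies with [X_t > l]. *)
have Tnt n : (Tn n w < t%:E)%E.
  have [s [s0 st sz Xs]] : exists s, [/\ 0 <= s, s < t, (s%:E < zeta w)%E & X s w < l + n.+1%:R^-1].
    have h : 0 < Num.min (n.+1%:R^-1) (X t w - l) by rewrite lt_min invSn_gt0 subr_gt0.
    have [s [s0 st sz Xs]] := lowt _ h.
    move: Xs; rewrite -ltrBlDl lt_min => /andP[X1 X2].
    exists s; split=> //; last by rewrite -ltrBlDl.
    by rewrite lt_neqAle st andbT; apply/eqP => E; move: X2; rewrite E ltxx.
  by apply: le_lt_trans (Tn_lt _ _ s0 sz Xs) _; rewrite lte_fin.
have Tn0 n : (0 <= Tn n w)%E by exact: Sinf_ge0.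
have TnE n : Tn n w = (fine (Tn n w))%:E.
  by rewrite fineK// ge0_fin_numE//; apply: lt_le_trans (Tnt n) _; exact: leey.
have tpos : 0 < t by rewrite -lte_fin; exact: le_lt_trans (Tnt 0%N).
have [L [_ hL]] := X_left_lim ss tpos tz.
have XL : X t w = L.
  have c1 := h1 Sz.
  have c2 : (fun n => X (fine (Tn n w)) w) @ \oo --> L.
    move/cvg_at_leftP : hL; apply; split.
      by move=> n; rewrite -lte_fin -TnE.
    apply: fine_cvg; rewrite -Sfin; exact: Sinf_cvg.
  exact: (cvg_unique _ c1 c2).
have LL : (L + l) / 2 < L by lra.
have [e e0 he] := near_at_left_itv (cvgr_gt _ hL _ LL).
have lowe : low l (t - e) w.
  apply: (low_retreat (m := (L + l) / 2)) lowt => //; first by lra.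
  by move=> s a b; apply/ltW/he.
have te0 : 0 <= t - e by have [s [s0 se _ _]] := lowe 1 ltr01; lra.
by move/(Sinf_leP ss _ _ te0) : lowe; rewrite Sfin lee_fin; lra.
Qed.

(** The events [Tminus l <= t] and [Sinf l <= t] differ by a negligible set, which completeness of
    the filtration absorbs. *)
Lemma Tminus_stopping l : stopping_time F (T l).
Proof.
split=> [w|t t0]; first exact: Tminus_ge0.
apply: (F_complete ss t0 (proj2 (Sinf_stopping l) t t0)).
apply: negl_subset (Tminus_Sinf_as l) => w /= h E; move: h; rewrite /setD /= E.
by move=> [[]|[]].
Qed.

End StoppingTimes.

(** * No negative jumps, continuity of the running infimum, continuity at the minimum *)

Section PathEquivalences.
Context {d : measure_display} {Omega : measurableType d} {R : realType}.
Variables (I : set R) (P : R -> probability Omega R) (F : R -> set (set Omega)).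
Variables (zeta : Omega -> \bar R) (X : R -> Omega -> R).
Hypothesis ss : standing_setting P I F zeta X.

Local Notation T := (Tminus zeta X).

Lemma Xinf_nonincr w s t : 0 <= s -> s <= t -> (t%:E < zeta w)%E -> Xinf X t w <= Xinf X s w.
Proof.
move=> s0 st tz; apply: Xinf_ge => // u u0 us; apply: (Xinf_le ss tz u0); lra.
Qed.

(** The infimum can only drop, so it suffices that the path does not fall by more than [e] near [t]:
    to the right this is right continuity, to the left it is the absence of a negative jump. *)
Lemma Xinf_continuous w :
  (forall t, 0 < t -> (t%:E < zeta w)%E -> X t w - Xleft X t w >= 0) ->
  {within [set t : R | 0 <= t /\ (t%:E < zeta w)%E], continuous (fun t => Xinf X t w)}.
Proof.
move=> hj; apply/subspace_continuousP => t [t0 tz].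
apply/cvgrPdist_le => e e0.
have Xe : X t w - e < X t w by lra.
have [e1 e10 h1] := right_gt ss t0 tz Xe.
(* With [L] the left limit at [t], one has [X_s < L + e/2], while the values on [[s, t)] exceed
   [L - e/2] and [X_t >= L]. *)
have [e2 [e20 h2]] : exists e2, 0 < e2 /\ forall s u, 0 <= s -> t - e2 < s -> s < t ->
    s <= u -> u <= t -> X s w - e <= X u w.
  move: t0; rewrite le_eqVlt => /predU1P[t0|t0].
    by exists 1; split=> // s u s0 _; rewrite -t0 ltNge s0.
  have [L [_ hL]] := X_left_lim ss t0 tz.
  have LE : Xleft X t w = L by exact: cvg_lim hL.
  have tL := hj t t0 tz; rewrite LE in tL.
  have LL1 : L - e / 2 < L by lra.
  have LL2 : L < L + e / 2 by lra.
  have [a a0 ha] := near_at_left_itv (cvgr_gt _ hL _ LL1).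
  have [b b0 hb] := near_at_left_itv (cvgr_lt _ hL _ LL2).
  exists (Num.min a b); split=> [|s u s0]; first by rewrite lt_min a0.
  rewrite ltrBlDl -ltrBlDr lt_min => /andP[sa sb] st su ut.
  have Xs : X s w < L + e / 2 by apply: hb => //; lra.
  move: ut; rewrite le_eqVlt => /predU1P[->|ut]; first by lra.
  have : L - e / 2 < X u w by apply: ha; lra.
  lra.
rewrite near_withinE; exists (Num.min e1 e2) => /=; first by rewrite lt_min e10.
move=> s /=; rewrite lt_min => /andP[]; rewrite !ltr_distlC => /andP[a1 a2] /andP[a3 a4] [s0 sz].
have [ts|st] := leP t s.
  have := Xinf_nonincr t0 ts sz; have : Xinf X t w - e <= Xinf X s w.
    apply: Xinf_ge => // u u0 us; have [ut|tu] := leP u t.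
      have := Xinf_le ss tz u0 ut; lra.
    have [||_] := h1 u; [lra|lra|].
    have := Xinf_le ss tz t0 (lexx t); lra.
  by rewrite ler_distlC; lra.
have := Xinf_nonincr s0 (ltW st) tz; have : Xinf X s w - e <= Xinf X t w.
  apply: Xinf_ge => // u u0 ut; have [us|su] := leP u s.
    have := Xinf_le ss sz u0 us; lra.
  have := h2 s u s0 a3 st (ltW su) ut.
  have := Xinf_le ss sz s0 (lexx s); lra.
by rewrite ler_distlC; lra.
Qed.

Lemma no_negative_jumps_inf_continuous :
  no_negative_jumps P I zeta X -> inf_continuous P I zeta X.
Proof. by apply: negl_subset => w /=; apply: contra_not; exact: Xinf_continuous. Qed.

Lemma Xc0_eq w x : (0 < zeta w)%E -> Xc zeta X 0 w = x%:E -> X 0 w = x.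
Proof. by move=> z0; rewrite /Xc z0 => -[]. Qed.

(** Before [T_a] the infimum is at least [a]; if [X_{T_a} < a] it drops below [a] by a fixed amount
    at [T_a]. The case [T_a = 0] is excluded by the starting value [x >= a]. *)
Lemma inf_continuous_cont_at_min :
  inf_continuous P I zeta X -> cont_at_min P I zeta X.
Proof.
move=> hc a x Ia Ix ax _.
apply: negligibleS (negligibleU (hc x Ix) (X_normal ss Ix)) => w /= [Tz XT].
apply: contrapT => /not_orP[/contrapT hcw /contrapT hx]; apply: XT.
have [t0 TE XT] := Tminus_attained ss Tz.
set t := fine (T a w) in t0 TE XT *.
have tz : (t%:E < zeta w)%E by rewrite -TE.
have z0 : (0 < zeta w)%E by apply: le_lt_trans tz; rewrite lee_fin.
apply/eqP; rewrite eq_le XT /= leNgt; apply/negP => Xa.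
have X0 := Xc0_eq z0 hx.
move: t0; rewrite le_eqVlt => /predU1P[t0|t0].
  by move: Xa; rewrite -t0 X0; lra.
have /subspace_continuousP/(_ t (conj (ltW t0) tz)) := hcw.
have ha : 0 < a - X t w by lra.
move=> /cvgrPdist_lt/(_ _ ha); rewrite near_withinE => -[e /= e0 he].
have [s [s0 se st]] : exists s, [/\ 0 <= s, `|t - s| < e & s < t].
  exists (Num.max 0 (t - e / 2)); rewrite le_max lexx gt_max t0 /=.
  by rewrite ltr_distlC gt_max lt_max; split=> //; lra.
have sz : (s%:E < zeta w)%E by apply: lt_trans tz; rewrite lte_fin.
have := he s se (conj s0 sz); rewrite ltr_distlC.
have : a <= Xinf X s w.
  apply: Xinf_ge => // u u0 us; apply/ltW/(Tminus_gt (zeta := zeta)) => //.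
    by apply: lt_trans tz; rewrite lte_fin; lra.
  by rewrite TE lte_fin; lra.
have := Xinf_le ss tz (ltW t0) (lexx t).
lra.
Qed.

End PathEquivalences.

(** * The path space and the event of a jump of the infimum *)

Section PathSpace.
Context {R : realType}.

(** The generators of [path_sigma], named so that the path space becomes a [measurableType]. *)
Definition path_gen : set (set (R -> \bar R)) :=
  [set A | exists (t : R) (B : set \bar R),
     [/\ 0 <= t, measurable B & A = [set p : R -> \bar R | B (p t)]]].

Definition pathT := g_sigma_algebraType path_gen.

Lemma path_coord_measurable t (B : set \bar R) : 0 <= t -> measurable B ->
  measurable ([set p | B (p t)] : set pathT).
Proof. by move=> t0 mB; apply: sub_sigma_algebra; exists t, B. Qed.

Lemma path_measurableP (H : (R -> \bar R) -> \bar R) :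
  measurable_fun setT (H : pathT -> \bar R) -> path_measurable H.
Proof. by move=> mH B mB; rewrite -[H @^-1` B]setTI; exact: (mH measurableT B mB). Qed.

Lemma bigcapT_measurable_rat d (T : measurableType d) (A : rat -> set T) :
  (forall q, measurable (A q)) -> measurable (\bigcap_q A q).
Proof.
move=> mA; rewrite -[X in measurable X]setCK setC_bigcap; apply: measurableC.
by apply: bigcupT_measurable_rat => q; exact: measurableC.
Qed.

Lemma measurable_ereal_le (c : \bar R) : measurable [set y : \bar R | (y <= c)%E].
Proof.
have -> : [set y : \bar R | (y <= c)%E] = [set` Interval -oo%O (BRight c)].
  by apply/seteqP; split=> y /=; rewrite in_itv.
exact: emeasurable_itv.
Qed.

Lemma measurable_ereal_ge (c : \bar R) : measurable [set y : \bar R | (c <= y)%E].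
Proof.
have -> : [set y : \bar R | (c <= y)%E] = [set` Interval (BLeft c) +oo%O].
  by apply/seteqP; split=> y /=; rewrite in_itv /= andbT.
exact: emeasurable_itv.
Qed.

(** A jump of the running infimum from at least [a] to at most [b], expressed through rational
    coordinates: arbitrarily close times [u < v], with the path at least [a] up to [u] and at most
    [b] at [v]. *)
Definition inf_jump (a b : R) : set (R -> \bar R) :=
  [set p | forall n : nat, exists u v : rat,
     [/\ 0 <= ratr u :> R, ratr u < ratr v :> R & ratr v < ratr u + n.+1%:R^-1 :> R] /\
     (p (ratr v) <= b%:E)%E /\
     forall r : rat, 0 <= ratr r :> R -> ratr r <= ratr u :> R -> (a%:E <= p (ratr r))%E].

Lemma inf_jump_measurable a b : measurable (inf_jump a b : set pathT).
Proof.
have -> : inf_jump a b = \bigcap_n \bigcup_u \bigcup_v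
   ([set p | [/\ 0 <= ratr u :> R, ratr u < ratr v :> R & ratr v < ratr u + n.+1%:R^-1 :> R] /\
     (p (ratr v) <= b%:E)%E] `&`
    \bigcap_r [set p | 0 <= ratr r :> R -> ratr r <= ratr u :> R -> (a%:E <= p (ratr r))%E]).
  apply/seteqP; split=> p /=.
    move=> h n _; have [u [v [h1 [h2 h3]]]] := h n.
    by exists u => //; exists v => //; split=> // r _; exact: h3.
  move=> h n; have [u _ [v _ [[h1 h2] h3]]] := h n Logic.I.
  by exists u, v; split=> //; split=> // r; exact: h3.
apply: bigcapT_measurable => n; apply: bigcupT_measurable_rat => u.
apply: bigcupT_measurable_rat => v; apply: measurableI; last first.
  apply: bigcapT_measurable_rat => r.
  have [h|h] := pselect (0 <= ratr r :> R /\ ratr r <= ratr u :> R).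
    rewrite (_ : [set p | _] = [set p : R -> \bar R | (a%:E <= p (ratr r))%E]).
      exact: (path_coord_measurable (proj1 h) (measurable_ereal_ge a%:E)).
    by apply/seteqP; split=> p //= h'; apply: h'; case: h.
  rewrite (_ : [set p | _] = setT); first exact: measurableT.
  by apply/seteqP; split=> p //= _ h1 h2; exfalso; apply: h.
have [h|h] := pselect [/\ 0 <= ratr u :> R, ratr u < ratr v :> R &
    ratr v < ratr u + n.+1%:R^-1 :> R].
  rewrite (_ : [set p | _] = [set p : R -> \bar R | (p (ratr v) <= b%:E)%E]).
    have v0 : 0 <= ratr v :> R by case: h => *; lra.
    exact: (path_coord_measurable v0 (measurable_ereal_le b%:E)).
  by apply/seteqP; split=> p //= [].
rewrite (_ : [set p | _] = set0); first exact: measurable0.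
by apply/seteqP; split=> p //= [].
Qed.

End PathSpace.

(** * Continuity at the minimum excludes negative jumps *)

Section NegativeJumps.
Context {d : measure_display} {Omega : measurableType d} {R : realType}.
Variables (I : set R) (P : R -> probability Omega R) (F : R -> set (set Omega)).
Variables (zeta : Omega -> \bar R) (X : R -> Omega -> R).
Hypothesis ss : standing_setting P I F zeta X.

Local Notation T := (Tminus zeta X).
Local Notation Xc := (Xc zeta X).

Lemma shifted_path_measurable r : 0 <= r ->
  measurable_fun setT ((fun w t => Xc (r + t) w) : Omega -> @pathT R).
Proof.
move=> r0; apply: (@measurability _ _ Omega (@pathT R) setT _ path_gen erefl).
move=> _ [_ [t [B [t0 mB ->]]] <-]; rewrite setTI.
have rt : 0 <= r + t by rewrite addr_ge0.
exact: (F_sub_measurable ss rt (X_adapted ss rt mB)).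
Qed.

Lemma path_measurable_fun : measurable_fun setT ((fun w t => Xc t w) : Omega -> @pathT R).
Proof.
have := shifted_path_measurable (lexx 0).
by congr measurable_fun; apply/funext => w; apply/funext => t; rewrite add0r.
Qed.

(** The passage time of the middle level lies in [(u, v]] for every pair [u, v] of the event. If the
    path exceeded [b] there, it would do so on an interval to the right, which contains [v] once
    [v - u] is small. *)
Lemma inf_jump_Tminus a b w : b < a -> inf_jump a b (fun t => Xc t w) ->
  [/\ (T ((a + b) / 2) w < zeta w)%E, X (fine (T ((a + b) / 2) w)) w <= b & a <= X 0 w].
Proof.
move=> ba h; set c := (a + b) / 2.
have XcE q y : (Xc q w <= y%:E)%E -> (q%:E < zeta w)%E /\ X q w <= y.
  by rewrite /Defs.Xc; case: ifP => // qz; rewrite lee_fin.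
have Xcge q y : (q%:E < zeta w)%E -> (y%:E <= Xc q w)%E -> y <= X q w.
  by rewrite /Defs.Xc => ->; rewrite lee_fin.
have [u [v [[u0 uv vu] [/XcE[vz Xv] hr]]]] := h 0%N.
have v0 : 0 <= ratr v :> R by lra.
have Tz : (T c w < zeta w)%E by apply: (Tminus_lt_zeta v0 vz); rewrite /c; lra.
have [t0 TE XT] := Tminus_attained ss Tz.
have z0 : (0%:E < zeta w)%E by apply: le_lt_trans vz; rewrite lee_fin.
split=> //; last first.
  by have := hr 0; rewrite rmorph0 => /(_ (lexx _) u0) /(Xcge _ _ z0).
set t := fine (T c w) in t0 TE XT *.
have tz : (t%:E < zeta w)%E by rewrite -TE.
rewrite leNgt; apply/negP => bX.
have [e e0 he] := right_gt ss t0 tz bX.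
have [n hn] := invSn_lt e0.
have {u v u0 uv vu vz Xv hr v0}[u [v [[u0 uv vu] [/XcE[vz Xv] hr]]]] := h n.
have v0 : 0 <= ratr v :> R by lra.
have uz : ((ratr u)%:E < zeta w)%E by apply: lt_trans vz; rewrite lte_fin.
have tv : t <= ratr v by rewrite -lee_fin -TE; apply: (Tminus_le v0 vz); rewrite /c; lra.
have ut : ratr u < t.
  rewrite ltNge le_eqVlt; apply/negP => /predU1P[tu|tu].
    have := Xcge _ _ uz (hr u u0 (lexx _)).
    by move: XT; rewrite tu /c; lra.
  have Xta : X t w < a by move: XT; rewrite /c; lra.
  have [e' e'0 he'] := right_lt ss t0 tz Xta.
  have hlt : t < Num.min (ratr u) (t + e') by rewrite lt_min tu; lra.
  have [q] := rat_in_itvoo hlt; rewrite in_itv /= lt_min => /andP[q1 /andP[q2 q3]].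
  have q0 : 0 <= ratr q :> R by lra.
  have [qz Xq] := he' (ratr q) (ltW q1) q3.
  by have := Xcge _ _ qz (hr q q0 (ltW q2)); lra.
have vte : ratr v < t + e.
  by apply: lt_trans vu _; apply: ltrD.
by have [_] := he (ratr v) tv vte; lra.
Qed.

Lemma cont_at_min_inf_jump a b y : cont_at_min P I zeta X -> b < a -> I y ->
  P y [set w | inf_jump a b (fun t => Xc t w)] = 0%E.
Proof.
move=> hc ba Iy.
have mN : measurable [set w | inf_jump a b (fun t => Xc t w)].
  rewrite -[X in measurable X]setTI.
  exact: (path_measurable_fun measurableT (inf_jump_measurable a b)).
apply/negligibleP => //.
set c := (a + b) / 2.
have key w : inf_jump a b (fun t => Xc t w) -> Xc 0 w = y%:E ->
    [/\ I c, c <= y, exists b', I b' /\ b' < c,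
      (T c w < zeta w)%E & X (fine (T c w)) w <> c].
  move=> /(inf_jump_Tminus ba)[Tz XT aX] X0y.
  have [t0 TE _] := Tminus_attained ss Tz.
  have tz : ((fine (T c w))%:E < zeta w)%E by rewrite -TE.
  have z0 : (0%:E < zeta w)%E by apply: le_lt_trans tz; rewrite lee_fin.
  have X0 := Xc0_eq z0 X0y.
  have IX := X_in_I ss t0 tz.
  have cy : c <= y by rewrite /c; lra.
  split=> //.
  - apply: (I_interval ss IX Iy); apply/andP; split=> //.
    by apply: le_trans XT _; rewrite /c; lra.
  - exists (X (fine (T c w)) w); split=> //.
    by apply: le_lt_trans XT _; rewrite /c; lra.
  - by move=> E; rewrite -/c E in XT; rewrite /c in XT; lra.
(* One path of the event started at [y] already shows that [c] belongs to [I] and is not its lower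
   endpoint, because [X_{T_c} <= b < c] lies in [I]. If there is none, the event lies in the null
   set where the path does not start at [y]. *)
have [[w [h1 h2]]|hn] := pselect (exists w, inf_jump a b (fun t => Xc t w) /\ Xc 0 w = y%:E).
  have [Ic cy hb _ _] := key w h1 h2.
  apply: negligibleS (negligibleU (hc c y Ic Iy cy hb) (X_normal ss Iy)) => v /= hv.
  have [/(key _ hv)[_ _ _ ? ?]|?] := pselect (Xc 0 v = y%:E); [by left|by right].
apply: negligibleS (X_normal ss Iy) => v /= hv E; apply: hn; by exists v.
Qed.

Lemma F_at_setT (S : Omega -> \bar R) : stopping_time F S -> F_at F S setT.
Proof.
move=> [S0 hS]; split; last by move=> t t0; rewrite setTI; exact: hS.
by apply: sub_sigma_algebra; exists 0 => //=; exact: (F_setT ss).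
Qed.

Lemma cst_stopping (s : R) : 0 <= s -> stopping_time F (fun=> s%:E).
Proof.
move=> s0; split=> [_|t t0]; first by rewrite lee_fin.
have [st|ts] := boolP (s%:E <= t%:E)%E.
  by rewrite (_ : [set w | _] = setT); [exact: (F_setT ss)|exact/seteqP].
rewrite (_ : [set w | _] = set0); first by have [] := F_sigma ss t0.
by rewrite -subset0 => w.
Qed.

Lemma cont_at_min_shifted_inf_jump a b s : cont_at_min P I zeta X -> b < a -> 0 <= s ->
  negl P I [set w | (s%:E < zeta w)%E /\ inf_jump a b (fun t => Xc (s + t) w)].
Proof.
move=> hc ba s0 x Ix.
have mH : path_measurable (fun p => (\1_(inf_jump a b) p)%:E : \bar R).
  apply: path_measurableP; apply/measurable_EFinP; apply: measurable_indic.
  exact: inf_jump_measurable.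
have mD : measurable [set w | (s%:E < zeta w)%E].
  rewrite (_ : [set w | _] = ~` [set w | (zeta w <= s%:E)%E]).
    by apply: measurableC; exact: (F_sub_measurable ss s0 (proj2 (zeta_stopping ss) s s0)).
  by apply/seteqP; split=> w /=; rewrite ltNge => /negP.
pose N := [set w | inf_jump a b (fun t => Xc (s + t) w)].
have mN : measurable N.
  rewrite -[X in measurable X]setTI.
  exact: (shifted_path_measurable s0 measurableT (inf_jump_measurable a b)).
have := X_strong_Markov ss (cst_stopping s0) mH _ Ix (F_at_setT (cst_stopping s0)).
rewrite setTI /Ex /= [RHS]integral0_eq; last first.
  move=> w sz; rewrite -[RHS](cont_at_min_inf_jump hc ba (X_in_I ss s0 sz)).
  rewrite -[in RHS](setIT [set v | _]) -integral_indic//.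
  rewrite -[X in measurable X]setTI.
  exact: (path_measurable_fun measurableT (inf_jump_measurable a b)).
move=> h.
have -> : [set w | (s%:E < zeta w)%E /\ inf_jump a b (fun t => Xc (s + t) w)] =
    N `&` [set w | (s%:E < zeta w)%E] by rewrite setIC.
apply/negligibleP; first exact: measurableI.
have E := integral_indic (P x) mD mN.
rewrite -[LHS]E; have {}h := h (fun p => ltac:(by rewrite lee_fin)).
exact: h.
Qed.

(** Rationals [b < a] are taken strictly between [X_t] and the left limit, and a rational [s] so
    close to [t] that the path stays above [a] on [[s, t)]. After restarting at [s] the infimum has
    not yet been lowered by earlier values, so the jump of [X] is one of the infimum. *)
Lemma negative_jump_inf_jump w t : 0 < t -> (t%:E < zeta w)%E -> X t w < Xleft X t w ->
  exists s a b : rat, [/\ 0 <= ratr s :> R, ratr b < ratr a :> R,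
    ((ratr s)%:E < zeta w)%E & inf_jump (ratr a) (ratr b) (fun u => Xc (ratr s + u) w)].
Proof.
move=> t0 tz; have [L [_ hL]] := X_left_lim ss t0 tz.
have -> : Xleft X t w = L by exact: cvg_lim hL.
move=> XL.
have [b] := rat_in_itvoo XL; rewrite in_itv /= => /andP[Xb bL].
have [a] := rat_in_itvoo bL; rewrite in_itv /= => /andP[ba aL].
have [e e0 he] := near_at_left_itv (cvgr_gt _ hL _ aL).
have [e1 e10 he1] := right_lt ss (ltW t0) tz Xb.
have hs : Num.max 0 (t - e) < t by rewrite gt_max t0; lra.
have [s] := rat_in_itvoo hs; rewrite in_itv /= gt_max => /andP[/andP[s0 se] st].
exists s, a, b; split=> //; first exact: ltW.
  by apply: lt_trans tz; rewrite lte_fin.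
move=> n; have h0 := invSn_gt0 R n; set h := n.+1%:R^-1 in h0 *.
have hu : Num.max 0 (t - ratr s - h / 2) < t - ratr s by rewrite gt_max; lra.
have [u] := rat_in_itvoo hu; rewrite in_itv /= gt_max => /andP[/andP[u0 uh] ut].
have hv : t - ratr s < t - ratr s + Num.min (h / 2) e1 by rewrite ltrDl lt_min e10; lra.
have [v] := rat_in_itvoo hv; rewrite in_itv /= -ltrBlDl lt_min => /andP[vt /andP[vh ve]].
exists u, v; split; first by split; lra.
split.
  have [||vz Xv] := he1 (ratr s + ratr v); [lra|lra|].
  by rewrite /Defs.Xc vz lee_fin ltW.
move=> r r0 ru; rewrite /Defs.Xc; case: ifP => _; last exact: leey.
by rewrite lee_fin; apply/ltW/he; lra.
Qed.

Lemma cont_at_min_no_negative_jumps :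
  cont_at_min P I zeta X -> no_negative_jumps P I zeta X.
Proof.
move=> hc x Ix.
pose G n := if unpickle n is Some (s, a, b) then
  if (0 <= ratr (s : rat) :> R) && (ratr (b : rat) < ratr (a : rat) :> R) then
    [set w | ((ratr s)%:E < zeta w)%E /\ inf_jump (ratr a) (ratr b) (fun t => Xc (ratr s + t) w)]
  else set0 else set0.
apply: negligibleS (@negligible_bigcup _ _ _ (P x) G _); last first.
  move=> n; rewrite /G; case: unpickle => [[[s a] b]|]; last exact: negligible_set0.
  case: ifP => [/andP[s0 ba]|_]; last exact: negligible_set0.
  exact: cont_at_min_shifted_inf_jump.
move=> w /= /existsNP[t /not_implyP[t0 /not_implyP[tz]]].
move=> /negP; rewrite -ltNge subr_lt0 => /(negative_jump_inf_jump t0 tz).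
move=> [s [a [b [s0 ba sz h]]]]; exists (pickle (s, a, b)); first exact: Logic.I.
rewrite /G pickleK s0 ba; exact: (conj sz h).
Qed.

End NegativeJumps.

(** * Lower integrals and comparison on a grid *)

Section LowerIntegral.
Context {d : measure_display} {T : measurableType d} {R : realType}.
Variable mu : {measure set T -> \bar R}.
Local Open Scope ereal_scope.

(** The integral of a nonnegative function is the supremum over the simple functions below it, hence
    monotone without measurability. *)
Lemma le_lower_integral (D : set T) (f g : T -> \bar R) :
  (forall x, D x -> 0 <= f x) -> (forall x, D x -> f x <= g x) ->
  \int[mu]_(x in D) f x <= \int[mu]_(x in D) g x.
Proof.
move=> f0 fg.
rewrite !ge0_integralE//; last by move=> x Dx; apply: le_trans (fg x Dx); exact: f0.
apply: ereal_sup_le => _ [h hf <-]; exists h => // x; apply: le_trans (hf x) _.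
by rewrite /patch; case: ifPn => // /set_mem Dx; exact: fg.
Qed.

(** Off a measurable null set [f] equals [g], so [f] lies between the two modifications of [g] by
    [0] and by [+oo] on that set; both are measurable with the integral of [g]. *)
Lemma lower_integral_ae_eq (D : set T) (f g : T -> \bar R) :
  measurable D -> measurable_fun D g ->
  (forall x, D x -> 0 <= f x) -> (forall x, D x -> 0 <= g x) ->
  mu.-negligible [set x | D x /\ f x <> g x] ->
  \int[mu]_(x in D) f x = \int[mu]_(x in D) g x.
Proof.
move=> mD mg f0 g0 [N [mN N0 hN]].
have fgE x : D x -> ~ N x -> f x = g x.
  by move=> Dx; apply: contra_notP => h; exact: hN.
have key c : 0 <= c -> \int[mu]_(x in D) (if x \in N then c else g x) = \int[mu]_(x in D) g x.
  move=> c0; rewrite (ge0_negligible_integral mN mD _ _ N0)//; first last.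
  - by move=> x Dx; case: ifP => // _; exact: g0.
  - apply: measurable_fun_if => //.
    + by apply: (measurable_fun_bool true); rewrite preimage_mem_true; exact: measurableI.
    + by apply: (measurable_funS mD) mg => // x [].
  rewrite [RHS](ge0_negligible_integral mN mD _ _ N0)//.
  by apply: eq_integral => x /set_mem[_ Nx]; rewrite memNset.
apply/eqP; rewrite eq_le; apply/andP; split.
  rewrite -(key +oo)//; apply: le_lower_integral => // x Dx.
  by case: ifPn => [_|/negP/= h]; [exact: leey|rewrite fgE// => Nx; apply: h; exact/mem_set].
rewrite -(key 0)//; apply: le_lower_integral => x Dx; case: ifPn => // h; first exact: g0.
  exact: f0.
by rewrite fgE// => Nx; move: h; rewrite mem_set.
Qed.

Lemma le_of_forall_mul_gt1 (x y : \bar R) : 0 <= y ->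
  (forall c : R, (1 < c)%R -> x <= c%:E * y) -> x <= y.
Proof.
move: y => [y| |//] y0 h; last exact: leey.
rewrite lee_fin in y0.
apply/lee_addgt0Pr => e e0.
have c1 : (1 < 1 + e / (y + 1))%R by rewrite ltrDl divr_gt0//; lra.
apply: le_trans (h _ c1) _; rewrite -EFinM -EFinD lee_fin mulrDl mul1r lerD2l.
rewrite mulrAC ler_pdivrMr; last by lra.
by rewrite ler_wpM2l//; lra.
Qed.

(** The cell of index [0] is [(-h, 0]], which takes in the value [0]. *)
Lemma grid_cell (h t : R) : (0 < h)%R -> (0 <= t)%R ->
  exists n : nat, (n%:R * h - h < t <= n%:R * h)%R.
Proof.
move=> h0 t0.
have ex : exists n : nat, (t <= n%:R * h)%R.
  exists (Num.trunc (t / h)).+1; rewrite -ler_pdivrMr//.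
  by apply/ltW; exact: truncnS_gt.
have [n nP nmin] := ex_minnP ex; exists n; rewrite nP andbT.
case: n nP nmin => [|n] nP nmin; first by rewrite mul0r; lra.
rewrite -natr1 mulrDl mul1r addrK ltNge; apply/negP => /nmin; by rewrite ltnn.
Qed.

(* The weight [exp (- q t)] varies by a factor [exp (q h)] at most on a cell of
   the grid of mesh [h], so a comparison on cells passes to weighted integrals. *)
Lemma grid_le_integral (D : set T) (t : T -> R) (q : R) (W1 W2 : T -> \bar R) :
  measurable D -> measurable_fun D t -> (forall x, D x -> 0 <= t x)%R -> (0 <= q)%R ->
  measurable_fun D W1 -> measurable_fun D W2 ->
  (forall x, D x -> 0 <= W1 x) -> (forall x, D x -> 0 <= W2 x) ->
  (forall u v : R, \int[mu]_(x in D `&` [set x | u < t x <= v]%R) W1 x <=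
                   \int[mu]_(x in D `&` [set x | u < t x <= v]%R) W2 x) ->
  \int[mu]_(x in D) ((expR (- q * t x))%:E * W1 x) <=
  \int[mu]_(x in D) ((expR (- q * t x))%:E * W2 x).
Proof.
move=> mD mt t0 q0 mW1 mW2 W10 W20 hW.
have e0 x : 0 <= (expR x)%:E :> \bar R by rewrite lee_fin expR_ge0.
apply: le_of_forall_mul_gt1.
  by apply: integral_ge0 => x Dx; apply: mule_ge0 => //; exact: W20.
move=> c c1.
(* The mesh is chosen so that [exp (q h) <= c]; the denominator [q + 1] also covers [q = 0]. *)
pose h := (ln c / (q + 1))%R.
have h0 : (0 < h)%R by rewrite divr_gt0 ?ln_gt0//; lra.
have qh : (expR (q * h) <= c)%R.
  rewrite -[leRHS]lnK ?posrE; last by lra.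
  rewrite ler_expR /h mulrA ler_pdivrMr; last by lra.
  by rewrite mulrC ler_wpM2l ?ln_ge0//; lra.
pose C (n : nat) := D `&` [set x | n%:R * h - h < t x <= n%:R * h]%R.
have mC n : measurable (C n).
  rewrite /C (_ : [set x | _] = t @^-1` [set` `](n%:R * h - h)%R, (n%:R * h)%R]]).
    exact: mt.
  by apply/seteqP; split=> x /=; rewrite in_itv.
have CD n : C n `<=` D by move=> x [].
have DC : D = \bigcup_n C n.
  apply/seteqP; split=> [x Dx|x [n _ []//]].
  by have [n hn] := grid_cell h0 (t0 x Dx); exists n.
have tC : trivIset setT C.
  apply/trivIsetP => i j _ _; wlog ij : i j / (i < j)%N => [H ij|_].
    move: (ij); rewrite neq_ltn => /orP[ij'|ij']; first exact: H.
    by rewrite setIC; apply: H => //; rewrite eq_sym.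
  rewrite -subset0 => x [[_ /andP[_ a]] [_ /andP[b _]]] /=.
  have : (i.+1%:R * h <= j%:R * h)%R by rewrite ler_wpM2r ?(ltW h0)// ler_nat.
  by rewrite -natr1 mulrDl; lra.
have mE : measurable_fun D (fun x => (expR (- q * t x))%:E).
  by apply/measurable_EFinP; apply: measurableT_comp => //; exact: measurable_funM.
have mEW W : measurable_fun D W -> measurable_fun D (fun x => (expR (- q * t x))%:E * W x).
  by move=> mW; exact: emeasurable_funM.
have sumE W : measurable_fun D W -> (forall x, D x -> 0 <= W x) ->
    \int[mu]_(x in D) ((expR (- q * t x))%:E * W x) =
    \sum_(0 <= n <oo) \int[mu]_(x in C n) ((expR (- q * t x))%:E * W x).
  move=> mW W0; rewrite {1}DC ge0_integral_bigcup// -DC//; first exact: mEW.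
  by move=> x Dx; apply: mule_ge0 => //; exact: W0.
rewrite sumE// sumE// -nneseriesZl; last first.
  move=> n _; apply: integral_ge0 => x Cx; apply: mule_ge0 => //.
  by apply: W20; exact: CD Cx.
apply: lee_nneseries => n _; first move=> _.
  apply: integral_ge0 => x Cx; apply: mule_ge0 => //; by apply: W10; exact: CD Cx.
apply: (@le_trans _ _ ((expR (- q * (n%:R * h - h)))%:E * \int[mu]_(x in C n) W1 x)).
  rewrite -(ge0_integralZl mu (mC n) (measurable_funS mD (@CD n) mW1)
    (fun x Cx => W10 x (@CD n x Cx)) (e0 _)).
  apply: le_lower_integral => x Cx; first by apply: mule_ge0 => //; apply: W10; exact: CD Cx.
  apply: lee_wpmul2r; first by apply: W10; exact: CD Cx.
  rewrite lee_fin ler_expR; case: Cx => _ /andP[/ltW a _].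
  by rewrite !mulNr lerN2 ler_wpM2l.
apply: (@le_trans _ _ ((expR (- q * (n%:R * h - h)))%:E * \int[mu]_(x in C n) W2 x)).
  by apply: lee_wpmul2l => //; exact: hW.
rewrite -ge0_integralZl//; last 2 first.
- exact: measurable_funS mW2.
- by move=> x /CD; exact: W20.
rewrite -ge0_integralZl//; last 3 first.
- by apply: measurable_funS (mEW _ mW2).
- by move=> x /CD Dx; apply: mule_ge0 => //; exact: W20.
- by rewrite lee_fin; lra.
apply: le_lower_integral => x Cx; first by apply: mule_ge0 => //; apply: W20; exact: CD Cx.
rewrite muleA; apply: lee_wpmul2r; first by apply: W20; exact: CD Cx.
rewrite -EFinM lee_fin; apply: le_trans (ler_wpM2r (expR_ge0 _) qh).
rewrite -expRD ler_expR; case: Cx => _ /andP[_ a].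
have : (q * t x <= q * (n%:R * h))%R by rewrite ler_wpM2l.
by rewrite mulrBr !mulNr; lra.
Qed.

End LowerIntegral.

(** * The discounted passage time as a measurable functional of the path *)

Section HittingFunctional.
Context {R : realType}.

(** Says [Sinf l <= t < zeta] through rational coordinates; the value [+oo] of a path stands for the
    cemetery. *)
Definition hit_event (l : R) (t : rat) : set (R -> \bar R) :=
  [set p | [/\ 0 <= ratr t :> R, (p (ratr t) < +oo)%E & forall m : nat, exists s : rat,
     [/\ 0 <= ratr s :> R, ratr s <= ratr t :> R & (p (ratr s) < (l + m.+1%:R^-1)%:E)%E]]].

Lemma hit_event_measurable l t : measurable (hit_event l t : set pathT).
Proof.
have [t0|t0] := leP 0 (ratr t : R); last first.
  rewrite (_ : hit_event l t = set0); first exact: measurable0.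
  by rewrite -subset0 => p []; rewrite leNgt t0.
have -> : hit_event l t = [set p | (p (ratr t) < +oo)%E] `&` \bigcap_m \bigcup_s
    [set p | [/\ 0 <= ratr s :> R, ratr s <= ratr t :> R & (p (ratr s) < (l + m.+1%:R^-1)%:E)%E]].
  apply/seteqP; split=> p /=.
    by move=> [_ h1 h2]; split=> // m _; have [s hs] := h2 m; exists s.
  by move=> [h1 h2]; split=> // m; have [s _ hs] := h2 m Logic.I; exists s.
apply: measurableI.
  have mB : measurable [set y : \bar R | (y < +oo)%E].
    rewrite (_ : [set y | _] = [set` Interval -oo%O (BLeft +oo%E)]).
      exact: emeasurable_itv.
    by apply/seteqP; split=> y /=; rewrite in_itv.
  exact: (path_coord_measurable t0 mB).
apply: bigcapT_measurable => m; apply: bigcupT_measurable_rat => s.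
have [h|h] := pselect (0 <= ratr s :> R /\ ratr s <= ratr t :> R).
  rewrite (_ : [set p | _] = [set p : R -> \bar R | (p (ratr s) < (l + m.+1%:R^-1)%:E)%E]).
    exact: (path_coord_measurable (proj1 h) (measurable_ereal_lt _)).
  by apply/seteqP; split=> p /=; [case|case: h].
rewrite (_ : [set p | _] = set0); first exact: measurable0.
by rewrite -subset0 => p [? ? _]; apply: h.
Qed.

Definition hit_term (q l : R) (n : nat) (p : R -> \bar R) : \bar R :=
  if unpickle n is Some t then (expR (- q * ratr t) * \1_(hit_event l t) p)%:E else 0%E.

(* On almost every path this is [exp (- q T_l) 1_{T_l < zeta}], computed from
   countably many coordinates only. *)
Definition hit_functional (q l : R) (p : R -> \bar R) : \bar R := esups (hit_term q l ^~ p) 0.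

Lemma hit_functional_measurable q l : path_measurable (hit_functional q l).
Proof.
apply: path_measurableP; apply: measurable_fun_esups => n.
rewrite /hit_term; case: unpickle => [t|]; last exact: measurable_cst.
apply/measurable_EFinP; apply: measurable_funM => //.
by apply: measurable_indic; exact: hit_event_measurable.
Qed.

Lemma hit_term_le q l n p : (hit_term q l n p <= hit_functional q l p)%E.
Proof. by apply: ereal_sup_ubound; exists n. Qed.

Lemma hit_functional_ge0 q l p : (0 <= hit_functional q l p)%E.
Proof.
apply: le_trans (hit_term_le q l 0 p); rewrite /hit_term; case: unpickle => [t|//].
by rewrite lee_fin mulr_ge0 ?expR_ge0.
Qed.

Lemma hit_functional_eq0 q l p : (forall t, ~ hit_event l t p) -> hit_functional q l p = 0%E.
Proof.
move=> h; apply/eqP; rewrite eq_le hit_functional_ge0 andbT.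
apply: ge_ereal_sup => _ [n _ <-]; rewrite /hit_term; case: unpickle => [t|//].
by rewrite indicE memNset ?mulr0.
Qed.

(** The rational times of the hit events lie in [[tau, +oo)] and approach [tau], so the supremum of
    the discounts is the discount at [tau]. *)
Lemma hit_functional_eq q l p tau : 0 <= q -> 0 <= tau ->
  (forall t, hit_event l t p -> tau <= ratr t) ->
  (forall e, 0 < e -> exists2 t, hit_event l t p & ratr t < tau + e) ->
  hit_functional q l p = (expR (- q * tau))%:E.
Proof.
move=> q0 tau0 h1 h2.
have Hle : (hit_functional q l p <= (expR (- q * tau))%:E)%E.
  apply: ge_ereal_sup => _ [n _ <-]; rewrite /hit_term; case: unpickle => [t|]; last first.
    by rewrite lee_fin expR_ge0.
  rewrite indicE lee_fin; case: (boolP (p \in _)) => [/set_mem/h1 ht|_]; last first.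
    by rewrite mulr0 expR_ge0.
  by rewrite mulr1 ler_expR !mulNr lerN2 ler_wpM2l.
apply/eqP; rewrite eq_le Hle /=; apply/lee_addgt0Pr => e e0.
(* A delay of [e / (q + 1)] costs at most [e], since [exp (- q e / (q + 1)) >= 1 - q e / (q + 1) >=
   1 - e]. *)
have e10 : 0 < e / (q + 1) by rewrite divr_gt0//; lra.
have [t ht te] := h2 _ e10.
apply: (@le_trans _ _ ((expR (- q * ratr t))%:E + e%:E)%E); last first.
  apply: leeD => //; apply: le_trans (hit_term_le q l (pickle t) p).
  by rewrite /hit_term pickleK indicE mem_set// mulr1.
rewrite -EFinD lee_fin.
have hx : expR (- q * tau) * expR (- q * (e / (q + 1))) <= expR (- q * ratr t).
  rewrite -expRD ler_expR -mulrDr !mulNr lerN2 ler_wpM2l//; exact: ltW.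
have hy : 1 - e <= expR (- q * (e / (q + 1))).
  apply: le_trans (expR_ge1Dx _).
  rewrite lerD2l mulNr lerN2 mulrCA -{2}[e]mulr1 ler_wpM2l ?(ltW e0)//.
  by rewrite ler_pdivrMr; lra.
have hz : expR (- q * tau) <= 1.
  by rewrite -expR0 ler_expR mulNr oppr_le0 mulr_ge0.
have hz0 := expR_ge0 (- q * tau).
have := ler_wpM2l hz0 hy; rewrite mulrBr mulr1.
have := ler_wpM2r (ltW e0) hz; rewrite mul1r.
move: hx; set A := expR (- q * tau); set B := expR _; set C := expR _; lra.
Qed.

End HittingFunctional.

(** * Evaluation of the functional on restarted paths *)

Section HittingValue.
Context {d : measure_display} {Omega : measurableType d} {R : realType}.
Variables (I : set R) (P : R -> probability Omega R) (F : R -> set (set Omega)).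
Variables (zeta : Omega -> \bar R) (X : R -> Omega -> R).
Hypothesis ss : standing_setting P I F zeta X.

Local Notation T := (Tminus zeta X).
Local Notation Xc := (Xc zeta X).

Lemma hit_event_Sinf l r t w : 0 <= r -> hit_event l t (fun u => Xc (r + u) w) ->
  ((r + ratr t)%:E < zeta w)%E /\ (Sinf zeta X l w <= (r + ratr t)%:E)%E.
Proof.
move=> r0 [t0 h1 h2]; split.
  by move: h1; rewrite /Defs.Xc; case: ifP.
apply/(Sinf_leP ss); first by rewrite addr_ge0.
move=> e e0; have [m hm] := invSn_lt e0; have [s [s0 st]] := h2 m.
rewrite /Defs.Xc; case: ifP => // sz; rewrite lte_fin => Xs.
exists (r + ratr s); split=> //; first by rewrite addr_ge0.
  by rewrite lerD2l.
by apply: lt_trans Xs _; rewrite ltrD2l.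
Qed.

(** The restarted path sees only times from [r] on, hence [r <= T_l]. Strictness of [T_l < r + t]
    leaves room for a rational time just after the passage, [T_l - r] itself being possibly
    irrational. *)
Lemma hit_event_Tminus l r t w : 0 <= r -> (r%:E <= T l w)%E -> (T l w < (r + ratr t)%:E)%E ->
  ((r + ratr t)%:E < zeta w)%E -> hit_event l t (fun u => Xc (r + u) w).
Proof.
move=> r0 rT Tt tz; have Tz := lt_trans Tt tz.
have [T0 TE XT] := Tminus_attained ss Tz.
set tau := fine (T l w) in T0 TE XT.
rewrite TE lee_fin in rT; rewrite TE lte_fin in Tt.
have tauz : (tau%:E < zeta w)%E by rewrite -TE.
split; first by lra.
  by rewrite /Defs.Xc tz ltry.
move=> m; have XT' : X tau w < l + m.+1%:R^-1.
  by apply: le_lt_trans XT _; rewrite ltrDl invSn_gt0.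
have [e e0 he] := right_lt ss T0 tauz XT'.
have hlt : tau - r < Num.min (ratr t) (tau - r + e) by rewrite lt_min; apply/andP; split; lra.
have [s] := rat_in_itvoo hlt; rewrite in_itv /= lt_min => /andP[s1 /andP[s2 s3]].
exists s; split; [lra|lra|].
have [||sz Xs] := he (r + ratr s); [lra|lra|].
by rewrite /Defs.Xc sz lte_fin.
Qed.

(** As long as [r <= T_l], the path restarted at [r] reaches [l] at time [T_l - r]. The rational
    description only sees [Sinf], so the two times are assumed to agree on the path. *)
Lemma hit_functional_shift q l r w : 0 <= q -> 0 <= r -> T l w = Sinf zeta X l w ->
  (r%:E <= T l w)%E -> hit_functional q l (fun u => Xc (r + u) w) =
  if (T l w < zeta w)%E then (expR (- q * (fine (T l w) - r)))%:E else 0%E.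
Proof.
move=> q0 r0 TS rT; have h1 t : hit_event l t (fun u => Xc (r + u) w) ->
    ((r + ratr t)%:E < zeta w)%E /\ (T l w <= (r + ratr t)%:E)%E.
  by rewrite TS; exact: hit_event_Sinf.
case: ifPn => [Tz|Tz]; last first.
  apply: hit_functional_eq0 => t /h1[tz Tt]; move/negP : Tz; apply.
  exact: le_lt_trans tz.
have [T0 TE XT] := Tminus_attained ss Tz.
have rT' : r <= fine (T l w) by rewrite -lee_fin -TE.
apply: hit_functional_eq => //; first by lra.
  by move=> t /h1[_]; rewrite {1}TE lee_fin; lra.
move=> e e0; have Tz' : ((fine (T l w))%:E < zeta w)%E by rewrite -TE.
have [e' e'0 he'] := lt_ereal_room Tz'.
have hlt : fine (T l w) - r < fine (T l w) - r + Num.min e e'.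
  by rewrite ltrDl lt_min e0.
have [t] := rat_in_itvoo hlt; rewrite in_itv /= -ltrBlDl lt_min => /andP[t1 /andP[t2 t3]].
exists t; last by lra.
apply: hit_event_Tminus => //; first by rewrite TE lte_fin; lra.
by apply: he'; lra.
Qed.

Lemma stopping_measurable S : stopping_time F S -> measurable_fun setT S.
Proof.
move=> [S0 hS]; apply: (measurability (@ErealGenOInfty.G R)).
  exact: ErealGenOInfty.measurableE.
move=> _ [_ [x ->] <-]; rewrite setTI.
have [x0|x0] := leP 0 x.
  rewrite (_ : _ @^-1` _ = ~` [set w | (S w <= x%:E)%E]).
    by apply: measurableC; exact: (F_sub_measurable ss x0 (hS x x0)).
  by apply/seteqP; split=> w /=; rewrite in_itv /= andbT ltNge => /negP.
rewrite (_ : _ @^-1` _ = setT); first exact: measurableT.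
apply/seteqP; split=> w //= _; rewrite in_itv /= andbT.
by apply: lt_le_trans (S0 w); rewrite lte_fin.
Qed.

Lemma hit_measurable l : measurable [set w | (T l w < zeta w)%E].
Proof.
rewrite -[X in measurable X]setTI; apply: measurable_lte => //.
  exact/stopping_measurable/(Tminus_stopping ss).
exact/stopping_measurable/(zeta_stopping ss).
Qed.

Lemma fine_Tminus_measurable l D : measurable_fun D (fun w => fine (T l w)).
Proof.
apply: measurable_funTS; apply: measurableT_comp => //.
exact/stopping_measurable/(Tminus_stopping ss).
Qed.

End HittingValue.

Lemma integral_pos_null {d} {T : measurableType d} {R : realType}
  (mu : {measure set T -> \bar R}) (D : set T) (f : T -> \bar R) :
  measurable D -> measurable_fun D f -> (forall x, D x -> (0 < f x)%E) ->
  (\int[mu]_(x in D) f x = 0)%E -> mu D = 0%E.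
Proof.
move=> mD mf f0 h; apply/negligibleP => //.
have /(ae_eq_integral_abs mu mD mf) : (\int[mu]_(x in D) `|f x| = 0)%E.
  rewrite -[RHS]h; apply: eq_integral => x /set_mem Dx.
  by rewrite gee0_abs// ltW// f0.
apply: negligibleS => x Dx /(_ Dx) /= fx; by have := f0 x Dx; rewrite fx ltxx.
Qed.

(** * Laplace transforms of passage times and the strong Markov property *)

Section Laplace.
Context {d : measure_display} {Omega : measurableType d} {R : realType}.
Variables (I : set R) (P : R -> probability Omega R) (F : R -> set (set Omega)).
Variables (zeta : Omega -> \bar R) (X : R -> Omega -> R).
Hypothesis ss : standing_setting P I F zeta X.

Local Notation T := (Tminus zeta X).
Local Notation Xc := (Xc zeta X).
Local Notation hit l := [set w | (T l w < zeta w)%E].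

(** The left-hand side of (S), convertible with the one in [identity_S]. *)
Definition hit_laplace q y l : \bar R := Ex P y (hit l) (fun w => (expR (- q * fine (T l w)))%:E).

Lemma expT_measurable q l D : measurable_fun D (fun w => (expR (- q * fine (T l w)))%:E).
Proof.
apply/measurable_EFinP; apply: measurableT_comp => //; apply: measurable_funM => //.
exact: (fine_Tminus_measurable ss).
Qed.

Lemma expT_le1 q l w : 0 <= q -> (expR (- q * fine (T l w)) <= 1 :> R).
Proof.
move=> q0; rewrite -expR0 ler_expR mulNr oppr_le0 mulr_ge0// fine_ge0//.
exact: Tminus_ge0.
Qed.

Lemma patch_hit_measurable l (f : Omega -> \bar R) : measurable_fun setT f ->
  measurable_fun setT (f \_ (hit l)).
Proof.
move=> mf; apply/(measurable_restrictT _ _).1; first exact: (hit_measurable ss).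
exact: measurable_funTS.
Qed.

Lemma patch_ge0 (f : Omega -> \bar R) D w : (forall v, D v -> (0 <= f v)%E) -> (0 <= (f \_ D) w)%E.
Proof. by move=> f0; rewrite /patch; case: ifPn => // /set_mem/f0. Qed.

Lemma laplace_ge0 q y l : (0 <= hit_laplace q y l)%E.
Proof. by apply: integral_ge0 => w _; rewrite lee_fin expR_ge0. Qed.

Lemma laplace_le_Pr q y l : 0 <= q -> (hit_laplace q y l <= Pr P y (hit l))%E.
Proof.
move=> q0; apply: le_lower_integral => w _; first by rewrite lee_fin expR_ge0.
by rewrite lee_fin expT_le1.
Qed.

Lemma Pr_measure y l : Pr P y (hit l) = P y (hit l).
Proof. by rewrite /Pr /Ex integral_cst ?mul1e//; exact: (hit_measurable ss). Qed.

Lemma laplace_le1 q y l : 0 <= q -> (hit_laplace q y l <= 1)%E.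
Proof.
move=> q0; apply: le_trans (laplace_le_Pr _ _ q0) _; rewrite Pr_measure.
exact: (probability_le1 _ (hit_measurable ss l)).
Qed.

Lemma laplace_fin q y l : 0 <= q -> hit_laplace q y l = (fine (hit_laplace q y l))%:E.
Proof.
move=> q0; rewrite fineK// ge0_fin_numE ?laplace_ge0//.
by apply: le_lt_trans (laplace_le1 y l q0) _; rewrite ltry.
Qed.

Lemma laplace_pos q y l : 0 <= q -> (0 < Pr P y (hit l))%E -> (0 < hit_laplace q y l)%E.
Proof.
move=> q0 hP; rewrite lt_neqAle laplace_ge0 andbT; apply/eqP => h.
move: hP; rewrite Pr_measure.
rewrite (integral_pos_null (hit_measurable ss l) (@expT_measurable q l _) _ (esym h)) ?ltxx//.
by move=> w _; rewrite lte_fin expR_gt0.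
Qed.

Lemma laplace_hit_functional q y l : 0 <= q -> I y ->
  Ex P y setT (fun v => hit_functional q l (fun t => Xc t v)) = hit_laplace q y l.
Proof.
move=> q0 Iy; rewrite /hit_laplace /Ex [RHS]integral_mkcond.
apply: lower_integral_ae_eq => //.
- by apply: patch_hit_measurable; exact: expT_measurable.
- by move=> w _; exact: hit_functional_ge0.
- by move=> w _; apply: patch_ge0 => v _; rewrite lee_fin expR_ge0.
apply: negligibleS (Tminus_Sinf_as ss l Iy) => w /= [_]; apply: contra_not => TS.
have -> : (fun t => Xc t w) = (fun t => Xc (0 + t) w).
  by apply/funext => t; rewrite add0r.
rewrite (hit_functional_shift ss) ?Tminus_ge0// subr0 /patch.
have [Tz|Tz] := boolP (T l w < zeta w)%E; first by rewrite mem_set.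
by rewrite memNset//; exact/negP.
Qed.

Lemma laplace_eq1 q y l : 0 <= q -> I y -> y <= l -> hit_laplace q y l = 1%E.
Proof.
move=> q0 Iy yl; rewrite /hit_laplace /Ex integral_mkcond.
transitivity (\int[P y]_w (cst 1 w : \bar R))%E; last first.
  by rewrite integral_cst// mul1e; exact: probability_setT.
apply: lower_integral_ae_eq => //.
  by move=> w _; apply: patch_ge0 => v _; rewrite lee_fin expR_ge0.
apply: negligibleS (X_normal ss Iy) => w /= [_]; apply: contra_not => X0y.
have z0 : (0%:E < zeta w)%E by move: X0y; rewrite /Defs.Xc; case: ifP.
have X0 := Xc0_eq z0 X0y.
have T0 : T l w = 0%E.
  apply/eqP; rewrite eq_le Tminus_ge0 andbT.
  by apply: (Tminus_le (lexx 0) z0); rewrite X0.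
by rewrite /patch mem_set /= ?T0//= mulr0 expR0.
Qed.

Lemma Tminus_level l a w : l <= a -> (T a w <= T l w)%E.
Proof.
move=> la; apply: ereal_inf_le_tmp => _ [t [t0 [tz Xt]] <-].
by exists t => //; split=> //; split=> //; exact: le_trans la.
Qed.

(** Supplies the events on which the strong Markov property is localised, as a substitute for
    weights that depend on [S]. *)
Lemma level_F_at S u v : stopping_time F S -> F_at F S [set w | (u%:E < S w <= v%:E)%E].
Proof.
move=> [S0 hS].
have F0 t : 0 <= t -> F t set0 by move=> t0; have [] := F_sigma ss t0.
have Fle r t : 0 <= t -> F t ([set w | (S w <= r%:E)%E] `&` [set w | (S w <= t%:E)%E]).
  move=> t0; have [r0|r0] := leP 0 r; last first.
    rewrite (_ : _ `&` _ = set0); first exact: F0.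
    rewrite -subset0 => w [/= /(le_trans (S0 w))]; by rewrite lee_fin leNgt r0.
  have [rt|tr] := leP r t.
    rewrite setIidl; first exact: (F_nondecreasing ss r0 rt (hS r r0)).
    by move=> w /= /le_trans; apply; rewrite lee_fin.
  rewrite setIidr; first exact: hS.
  by move=> w /= /le_trans; apply; rewrite lee_fin ltW.
have FA t : 0 <= t -> F t ([set w | (u%:E < S w <= v%:E)%E] `&` [set w | (S w <= t%:E)%E]).
  move=> t0.
  rewrite (_ : _ `&` _ = ([set w | (S w <= v%:E)%E] `&` [set w | (S w <= t%:E)%E]) `&`
     ~` ([set w | (S w <= u%:E)%E] `&` [set w | (S w <= t%:E)%E])).
    exact: (F_setI ss t0 (Fle v t t0) (F_setC ss t0 (Fle u t t0))).
  apply/seteqP; split=> w /=.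
    by move=> [/andP[uS Sv] St]; split=> // -[]; rewrite leNgt uS.
  move=> [[Sv St] h]; split=> //; rewrite Sv andbT ltNge; apply/negP => Su.
  exact: h.
split=> //; apply: sub_sigma_algebra; exists (Num.max 0 v) => /=; first by rewrite le_max lexx.
rewrite (_ : [set w | _] = [set w | (u%:E < S w <= v%:E)%E] `&` [set w | (S w <= (Num.max 0 v)%:E)%E]).
  by apply: FA; rewrite le_max lexx.
rewrite setIidl// => w /= /andP[_ /le_trans]; apply; by rewrite lee_fin le_max lexx orbT.
Qed.

(** The discount collected between [T_a] and [T_l], and [0] if [l] is not reached during the
    lifetime. *)
Definition after_ratio q l a : Omega -> \bar R :=
  (fun w => (expR (- q * (fine (T l w) - fine (T a w))))%:E) \_ (hit l).

Lemma after_ratio_measurable q l a : measurable_fun setT (after_ratio q l a).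
Proof.
apply: patch_hit_measurable; apply/measurable_EFinP; apply: measurableT_comp => //.
by apply: measurable_funM => //; apply: measurable_funB; exact: (fine_Tminus_measurable ss).
Qed.

Lemma after_ratio_ge0 q l a w : (0 <= after_ratio q l a w)%E.
Proof. by apply: patch_ge0 => v _; rewrite lee_fin expR_ge0. Qed.

Lemma hit_cell_measurable a u v :
  measurable ([set w | (u%:E < T a w <= v%:E)%E] `&` hit a).
Proof.
apply: measurableI; last exact: (hit_measurable ss).
have mT := stopping_measurable ss (Tminus_stopping ss a).
rewrite (_ : [set w | _] = T a @^-1` [set` Interval (BRight u%:E) (BRight v%:E)]).
  by rewrite -[X in measurable X]setTI; apply: mT => //; exact: emeasurable_itv.
by apply/seteqP; split=> w /=; rewrite in_itv.
Qed.

(** Strong Markov property at [T_a], with the path functional replaced by its almost sure values on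
    both sides: by [hit_functional_shift] at time [T_a] on the left, by [laplace_hit_functional]
    under the law started at [X_{T_a}] on the right. *)
Lemma markov_cell q l a x u v : 0 <= q -> l <= a -> I x ->
  (\int[P x]_(w in [set w | (u%:E < T a w <= v%:E)%E] `&` hit a) after_ratio q l a w =
   \int[P x]_(w in [set w | (u%:E < T a w <= v%:E)%E] `&` hit a)
      hit_laplace q (X (fine (T a w)) w) l)%E.
Proof.
move=> q0 la Ix.
have Tst := Tminus_stopping ss a.
have := X_strong_Markov ss Tst (@hit_functional_measurable R q l)
  (hit_functional_ge0 q l) Ix (level_F_at u v Tst).
rewrite {1 2}/Ex => h.
transitivity (\int[P x]_(w in [set w | (u%:E < T a w <= v%:E)%E] `&` hit a)
  hit_functional q l (fun t => Xc (fine (T a w) + t) w))%E.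
  apply/esym; apply: lower_integral_ae_eq.
  - exact: hit_cell_measurable.
  - by apply: measurable_funTS; exact: after_ratio_measurable.
  - by move=> w _; exact: hit_functional_ge0.
  - by move=> w _; exact: after_ratio_ge0.
  apply: negligibleS (Tminus_Sinf_as ss l Ix) => w /= [[_ Tz]]; apply: contra_not => TS.
  have [T0 TE _] := Tminus_attained ss Tz.
  rewrite (hit_functional_shift ss)//; last by rewrite -TE; exact: Tminus_level.
  rewrite /after_ratio /patch.
  have [Tlz|Tlz] := boolP (T l w < zeta w)%E; first by rewrite mem_set.
  by rewrite memNset//; exact/negP.
rewrite h; apply: eq_integral => w /set_mem[_ /= Tz].
have [T0 TE _] := Tminus_attained ss Tz.
apply: laplace_hit_functional => //; apply: (X_in_I ss) => //.
by rewrite -TE.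
Qed.

Lemma hit_cellE a u v : [set w | (u%:E < T a w <= v%:E)%E] `&` hit a =
  hit a `&` [set w | u < fine (T a w) <= v].
Proof.
have E w : hit a w -> (u%:E < T a w <= v%:E)%E = (u < fine (T a w) <= v).
  by move=> /(Tminus_attained ss)[_ TE _]; rewrite [in LHS]TE lte_fin lee_fin.
by rewrite setIC; apply/seteqP; split=> w [Tz] /=; rewrite E.
Qed.

Lemma laplace_after_ratio q l a x : l <= a ->
  (\int[P x]_(w in hit a) ((expR (- q * fine (T a w)))%:E * after_ratio q l a w))%E =
  hit_laplace q x l.
Proof.
move=> la; rewrite /hit_laplace /Ex.
have -> : hit l = hit a `&` hit l.
  rewrite setIidr// => w /= Tz; exact: le_lt_trans (Tminus_level w la) Tz.
rewrite integral_mkcondr; apply: eq_integral => w _; rewrite /after_ratio /patch.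
case: ifP => _; last by rewrite mule0.
by rewrite -EFinM -expRD -mulrDr addrC subrK.
Qed.

Lemma hit_grid_le q a x (W1 W2 : Omega -> \bar R) : 0 <= q ->
  measurable_fun (hit a) W1 -> measurable_fun (hit a) W2 ->
  (forall w, hit a w -> (0 <= W1 w)%E) -> (forall w, hit a w -> (0 <= W2 w)%E) ->
  (forall u v : R,
    (\int[P x]_(w in [set w | (u%:E < T a w <= v%:E)%E] `&` hit a) W1 w <=
     \int[P x]_(w in [set w | (u%:E < T a w <= v%:E)%E] `&` hit a) W2 w)%E) ->
  (\int[P x]_(w in hit a) ((expR (- q * fine (T a w)))%:E * W1 w) <=
   \int[P x]_(w in hit a) ((expR (- q * fine (T a w)))%:E * W2 w))%E.
Proof.
move=> q0 m1 m2 p1 p2 h; apply: grid_le_integral => //.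
- exact: (hit_measurable ss).
- exact: (fine_Tminus_measurable ss).
- by move=> w _; rewrite fine_ge0// Tminus_ge0.
- by move=> u v; rewrite -hit_cellE.
Qed.

End Laplace.

(** * Multiplicativity, strictness and continuity of the Laplace transform *)

Section ScaleFunction.
Context {d : measure_display} {Omega : measurableType d} {R : realType}.
Variables (I : set R) (P : R -> probability Omega R) (F : R -> set (set Omega)).
Variables (zeta : Omega -> \bar R) (X : R -> Omega -> R).
Hypothesis ss : standing_setting P I F zeta X.

Local Notation T := (Tminus zeta X).
Local Notation Xc := (Xc zeta X).
Local Notation hit l := [set w | (T l w < zeta w)%E].
Local Notation laplace := (hit_laplace P zeta X).
Local Notation after_ratio := (after_ratio zeta X).

(** Since [X_{T_a} = a] almost surely, [after_ratio] has on every cell the same integral as the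
    constant [laplace q a l]; the grid comparison in both directions adds the weight. The level
    [l < a] witnesses that [a] is not the lower endpoint of [I]. *)
Lemma laplace_mul q l a x : 0 <= q -> cont_at_min P I zeta X ->
  I l -> I a -> I x -> l < a -> a <= x ->
  laplace q x l = (laplace q x a * laplace q a l)%E.
Proof.
move=> q0 hc Il Ia Ix la ax.
rewrite -(laplace_after_ratio P zeta X q x (ltW la)).
set c := laplace q a l.
have c0 : (0 <= c)%E by exact: laplace_ge0.
have mR : measurable_fun (hit a) (after_ratio q l a).
  by apply: measurable_funTS; exact: (after_ratio_measurable ss).
have cell u v :
  (\int[P x]_(w in [set w | (u%:E < T a w <= v%:E)%E] `&` hit a) after_ratio q l a w =
   \int[P x]_(w in [set w | (u%:E < T a w <= v%:E)%E] `&` hit a) (cst c w))%E.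
  rewrite (markov_cell ss)//; last exact: ltW.
  apply: lower_integral_ae_eq => //.
  - exact: (hit_cell_measurable ss).
  - by move=> w _; exact: laplace_ge0.
  apply: negligibleS (hc a x Ia Ix ax _); last by exists l.
  by move=> w /= [[_ Tz] h]; split=> // E; apply: h; rewrite E.
transitivity (\int[P x]_(w in hit a) ((expR (- q * fine (T a w)))%:E * cst c w))%E.
  have mc : measurable_fun (hit a) (cst c) by exact: measurable_cst.
  have R0 w : hit a w -> (0 <= after_ratio q l a w)%E by move=> _; exact: after_ratio_ge0.
  have C0 w : hit a w -> (0 <= cst c w)%E by [].
  apply/eqP; rewrite eq_le; apply/andP; split.
    by apply: (hit_grid_le ss q0 mR mc R0 C0) => u v; rewrite cell.
  by apply: (hit_grid_le ss q0 mc mR C0 R0) => u v; rewrite cell.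
have mH := hit_measurable ss a.
have mE := @expT_measurable _ _ _ _ _ _ _ _ ss q a (hit a).
have E0 w : hit a w -> (0 <= (expR (- q * fine (T a w)))%:E)%E by rewrite lee_fin expR_ge0.
by rewrite ge0_integralZr.
Qed.

(** For [q > 0] the discount is below [1] on the almost sure event [X_0 = x]: there [T_l = 0] would
    give [X_0 <= l < x]. An expectation equal to [1] would make this event null. *)
Lemma laplace_lt1 q l x : 0 < q -> I x -> l < x -> (laplace q x l < 1)%E.
Proof.
move=> q0 Ix lx; rewrite lt_neqAle (laplace_le1 ss)// ?(ltW q0)// andbT; apply/eqP => h1.
pose f : Omega -> \bar R := (fun w => (expR (- q * fine (T l w)))%:E) \_ (hit l).
have mf : measurable_fun setT f.
  by apply: (patch_hit_measurable ss); exact: (expT_measurable ss).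
have f0 w : (0 <= f w)%E by apply: patch_ge0 => v _; rewrite lee_fin expR_ge0.
have f1 w : (f w <= 1)%E.
  by rewrite /f /patch; case: ifP => // _; rewrite lee_fin expT_le1// ltW.
have ffin w : f w \is a fin_num by rewrite ge0_fin_numE//; apply: le_lt_trans (f1 w) _; rewrite ltry.
have if1 : (\int[P x]_w f w = 1)%E by rewrite -[RHS]h1 /hit_laplace /Ex [RHS]integral_mkcond.
have mg : measurable_fun setT (fun w => 1 - f w)%E by apply: emeasurable_funB.
have g0 w : (0 <= 1 - f w)%E by rewrite sube_ge0// ffin.
have ig : (\int[P x]_w (1 - f w) = 0)%E.
  have : (\int[P x]_w ((1 - f w) + f w) = \int[P x]_w (1 - f w) + \int[P x]_w f w)%E.
    by rewrite ge0_integralD.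
  under eq_integral do rewrite subeK//.
  have -> : (\int[P x]_(w in setT) (1%E : \bar R) = 1)%E.
    by rewrite integral_cst// mul1e; exact: probability_setT.
  rewrite if1 => h.
  have : (1 - 1 = \int[P x]_w (1 - f w) :> \bar R)%E by rewrite {1}h addeK.
  by rewrite subee.
pose E := [set w | Xc 0 w = x%:E].
have mE : measurable E.
  exact: (F_sub_measurable ss (lexx 0) (X_adapted ss (lexx 0) (emeasurable_set1 x%:E))).
have PE : P x E = 1%E.
  have : P x (~` E) = 0%E by apply/negligibleP; [exact: measurableC|exact: (X_normal ss Ix)].
  move=> h; have := probability_setC (P x) (measurableC mE).
  by rewrite setCK h sube0.
have : P x E = 0%E.
  apply: (@integral_pos_null _ _ _ _ _ (fun w => 1 - f w)%E) => //.
  - exact: measurable_funTS.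
  - move=> w Ew; rewrite sube_gt0 /f /patch; case: ifPn => [/set_mem/= Tz|_]; last by rewrite lte_fin.
    have [T0 TE XT] := Tminus_attained ss Tz.
    rewrite lte_fin -expR0 ltr_expR mulNr oppr_lt0 mulr_gt0// lt_neqAle T0 andbT.
    apply/eqP => T00.
    have z0 : (0%:E < zeta w)%E by apply: le_lt_trans Tz; rewrite TE lee_fin.
    by move: XT; rewrite -T00 (Xc0_eq z0 Ew) leNgt lx.
  - apply/eqP; rewrite eq_le integral_ge0// andbT -ig.
    by apply: ge0_subset_integral => //.
by rewrite PE => /eqP; rewrite onee_eq0.
Qed.

(** Dominated convergence. Off a null set [Tminus] agrees with [Sinf] at [l] and at the countably
    many levels [l + 1/(n+1)], so the passage times converge by [Sinf_cvg]. *)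
Lemma laplace_cvg q l x : 0 < q -> I x ->
  (fun n => laplace q x (l + n.+1%:R^-1)) @ \oo --> laplace q x l.
Proof.
move=> q0 Ix.
pose f c : Omega -> \bar R := (fun w => (expR (- q * fine (T c w)))%:E) \_ (hit c).
have mf c : measurable_fun setT (f c).
  by apply: (patch_hit_measurable ss); exact: (expT_measurable ss).
have f0 c w : (0 <= f c w)%E by apply: patch_ge0 => v _; rewrite lee_fin expR_ge0.
have f1 c w : (f c w <= 1)%E.
  by rewrite /f /patch; case: ifP => // _; rewrite lee_fin expT_le1// ltW.
have fE c : laplace q x c = (\int[P x]_w f c w)%E by rewrite /hit_laplace /Ex integral_mkcond.
rewrite fE; under eq_fun do rewrite fE.
pose bad c := [set w | T c w <> Sinf zeta X c w].
have nbad c : (P x).-negligible (bad c) by exact: (Tminus_Sinf_as ss c Ix).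
have nbadn := negligible_bigcup (fun n => nbad (l + n.+1%:R^-1)).
have [] := @dominated_convergence _ _ _ (P x) setT measurableT
  (fun n => f (l + n.+1%:R^-1)) (f l) (cst 1%E) (fun n => mf _) (mf l) _ _ _.
- apply: negligibleS (negligibleU (nbad l) nbadn) => w.
  apply: contra_notP => /not_orP[/contrapT TS hn] _.
  have TSn n : T (l + n.+1%:R^-1) w = Sinf zeta X (l + n.+1%:R^-1) w.
    by apply: contrapT => h; apply: hn; exists n.
  have Tcvg : (fun n => T (l + n.+1%:R^-1) w) @ \oo --> T l w.
    by rewrite TS; under eq_fun do rewrite TSn; exact: (Sinf_cvg ss).
  have fT c t : T c w = t%:E -> f c w = (expR (- q * t))%:E.
    move=> E; rewrite /f /patch; case: ifPn => [_|/negP h]; first by rewrite E.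
    have zT : (zeta w <= T c w)%E.
      by rewrite leNgt; apply/negP => h'; apply: h; exact: mem_set.
    by have := Tminus_ge_zeta zT; rewrite E.
  have [Tz|zT] := boolP (T l w < zeta w)%E.
    have [T0 TE _] := Tminus_attained ss Tz.
    have Tnle n : (T (l + n.+1%:R^-1) w <= T l w)%E.
      by apply: Tminus_level; rewrite lerDl ltW// invSn_gt0.
    have TnE n : T (l + n.+1%:R^-1) w = (fine (T (l + n.+1%:R^-1) w))%:E.
      rewrite fineK// ge0_fin_numE ?Tminus_ge0//.
      by apply: le_lt_trans (Tnle n) _; rewrite TE ltry.
    rewrite (fT _ _ TE); under eq_fun do rewrite (fT _ _ (TnE _)).
    apply: cvg_EFin; first by near=> n.
    apply: (@cvg_comp _ _ _ (fun n => - q * fine (T (l + n.+1%:R^-1) w)) expR).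
      have Tc : (fun n => T (l + n.+1%:R^-1) w) @ \oo --> (fine (T l w))%:E by rewrite -TE.
      by apply: cvgMr; exact: (fine_cvg Tc).
    exact: continuous_expR.
  (* The approximating levels may all be reached, at times tending to infinity; [q > 0] makes their
     discounts vanish. *)
  have Too : T l w = +oo%E by apply: Tminus_ge_zeta; rewrite leNgt.
  have -> : f l w = 0%E.
    by rewrite /f /patch memNset//= Too; apply/negP; rewrite -leNgt leey.
  rewrite Too in Tcvg.
  apply: cvg_EFin.
    near=> n; rewrite ge0_fin_numE//; apply: le_lt_trans (f1 _ _) _; exact: ltry.
  apply/cvgr0Pnorm_le => e e0.
  have /cvgeyPge/(_ (- ln e / q)) := Tcvg; apply: filterS => n Mn.
  rewrite /= ger0_norm ?fine_ge0// /f /patch; case: ifPn => [/set_mem/= Tz|_]; last exact: ltW.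
  have [T0 TE _] := Tminus_attained ss Tz.
  rewrite /= -[leRHS]lnK// ler_expR mulNr lerNl -ler_pdivrMl// mulrC.
  by move: Mn; rewrite TE lee_fin.
- exact: finite_measure_integrable_cst.
- by apply: aeW => w n _; rewrite gee0_abs.
by move=> _ _.
Unshelve. all: by end_near. Qed.

End ScaleFunction.

(** * Construction of the scale functions *)

Section ScaleExistence.
Context {d : measure_display} {Omega : measurableType d} {R : realType}.
Variables (I : set R) (P : R -> probability Omega R) (F : R -> set (set Omega)).
Variables (zeta : Omega -> \bar R) (X : R -> Omega -> R).
Hypothesis ss : standing_setting P I F zeta X.

Local Notation laplace := (hit_laplace P zeta X).

Lemma I_between x y z : I x -> I y -> x <= z -> z <= y -> I z.
Proof. by move=> Ix Iy xz zy; apply: (I_interval ss Ix Iy); rewrite xz. Qed.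

Lemma scale_right_continuous q Phi : 0 < q -> (forall x, I x -> 0 < Phi x) ->
  (forall x y, I x -> I y -> x <= y -> Phi y <= Phi x) ->
  identity_S P I zeta X q Phi -> forall x, I x -> Phi @ x^'+ --> Phi x.
Proof.
move=> q0 Phi0 Phimono hS x Ix.
(* A starting point above [x + 1] dominates all levels [x + 1/(n+1)], so (S) applies to each with
   the same numerator [Phi x0]. Monotonicity of [Phi] then passes from this sequence to all [y]
   decreasing to [x]. *)
have [x0 [Ix0 xx0]] := I_unbounded_above ss (x + 1).
pose u n : R := x + n.+1%:R^-1.
have xu n : x < u n by rewrite ltrDl invSn_gt0.
have ux0 n : u n <= x0.
  apply: le_trans (ltW xx0); rewrite lerD2l invf_le1 ?ltr0n// ler1n//.
have Iu n : I (u n) by apply: (I_between Ix Ix0) => //; exact: ltW.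
have c1 : (fun n => Phi x0 / Phi (u n)) @ \oo --> Phi x0 / Phi x.
  have := laplace_cvg ss (l := x) q0 Ix0.
  have xx0' : x <= x0 by apply: le_trans (ux0 0%N); exact: ltW.
  have -> : (fun n => laplace q x0 (x + n.+1%:R^-1)) = (fun n => (Phi x0 / Phi (u n))%:E).
    by apply/funext => n; exact: (hS (u n) x0 (Iu n) Ix0 (ux0 n)).
  rewrite (_ : laplace q x0 x = (Phi x0 / Phi x)%:E); last exact: hS.
  by move=> /fine_cvg.
have P0 : Phi x0 != 0 by rewrite gt_eqF// Phi0.
have c2 : (fun n => Phi (u n)) @ \oo --> Phi x.
  have E y : I y -> Phi y = Phi x0 * (Phi x0 / Phi y)^-1.
    by move=> Iy; rewrite invf_div mulrCA divff ?mulr1.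
  rewrite [X in _ --> X](E x Ix).
  under eq_fun do rewrite (E _ (Iu _)).
  apply: cvgMr; apply: cvgV => //.
  by rewrite mulf_neq0// invr_neq0// gt_eqF// Phi0.
apply/cvgrPdist_le => e e0.
have /cvgrPdist_le/(_ e e0)[n _ /(_ n (leqnn n)) /= hn] := c2.
near=> y.
have xy : x < y by near: y; exact: nbhs_right_gt.
have yu : y < u n by near: y; apply: nbhs_right_lt; exact: xu.
have Iy : I y by apply: (I_between Ix (Iu n)); exact: ltW.
have h1 := Phimono _ _ Ix Iy (ltW xy).
have h2 := Phimono _ _ Iy (Iu n) (ltW yu).
have h3 := Phimono _ _ Ix (Iu n) (ltW (xu n)).
move: hn; rewrite !ger0_norm; lra.
Unshelve. all: by end_near. Qed.

Lemma cont_at_min_statement_iii :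
  cont_at_min P I zeta X -> condP P I zeta X -> statement_iii P I zeta X.
Proof.
move=> hc hP q q0.
pose psi x l := fine (laplace q x l).
have psiE x l : laplace q x l = (psi x l)%:E by exact: (laplace_fin ss).
clearbody psi.
have psi0 x l : I x -> I l -> l <= x -> 0 < psi x l.
  move=> Ix Il lx; rewrite -lte_fin -psiE; apply: (laplace_pos ss) => //.
  exact: hP.
have psi1 x l : psi x l <= 1 by rewrite -lee_fin -psiE; exact: (laplace_le1 ss).
have psixx x : I x -> psi x x = 1.
  by move=> Ix; apply: EFin_inj; rewrite -psiE (laplace_eq1 ss).
have psiM x a l : I l -> I a -> I x -> l <= a -> a <= x -> psi x l = psi x a * psi a l.
  move=> Il Ia Ix; rewrite le_eqVlt => /predU1P[->|la] ax.
    by rewrite psixx// mulr1.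
  apply: EFin_inj; rewrite EFinM -(psiE x l) -(psiE x a) -(psiE a l).
  exact: (laplace_mul ss).
have [x0 [Ix0 _]] := I_unbounded_above ss 0.
(* Normalised by [Phi x0 = 1]: (S) with lower level [x0] forces the first branch, and with starting
   point [x0] the second. *)
pose Phi x := if x0 <= x then psi x x0 else (psi x0 x)^-1.
have Phi0 x : I x -> 0 < Phi x.
  move=> Ix; rewrite /Phi; case: (leP x0 x) => [x0x|xx0]; first exact: psi0.
  by rewrite invr_gt0 psi0// ltW.
have PhiS l x : I l -> I x -> l <= x -> psi x l = Phi x / Phi l.
  move=> Il Ix lx; rewrite /Phi.
  have n0 y z : I y -> I z -> z <= y -> psi y z != 0 by move=> *; rewrite gt_eqF// psi0.
  have [x0l|lx0] := leP x0 l.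
    have x0x := le_trans x0l lx; rewrite x0x (psiM x l x0)// mulfK//.
    exact: n0.
  have [x0x|xx0] := leP x0 x.
    by rewrite invrK -psiM// ltW.
  rewrite invrK (psiM x0 x l)// ?(ltW xx0)// mulKf//.
  by apply: n0 => //; exact: ltW.
clearbody Phi.
have mono x y : I x -> I y -> x <= y -> Phi y <= Phi x.
  move=> Ix Iy xy; have := psi1 y x.
  by rewrite (PhiS _ _ Ix Iy xy) ler_pdivrMr ?mul1r//; exact: Phi0.
have hS : identity_S P I zeta X q Phi.
  by move=> l x Il Ix lx; rewrite -PhiS//; exact: psiE.
exists Phi; split=> // qpos; split; last exact: (scale_right_continuous qpos).
move=> x y Ix Iy xy.
have : psi y x < 1 by rewrite -lte_fin -psiE; exact: (laplace_lt1 ss).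
by rewrite (PhiS _ _ Ix Iy (ltW xy)) ltr_pdivrMr ?mul1r//; exact: Phi0.
Qed.

Lemma statement_iii_iv : statement_iii P I zeta X -> statement_iv P I zeta X.
Proof.
move=> /(_ 1 ler01)[Phi [Phi0 _ /(_ ltr01)[Phidec _] hS]].
by exists 1; split=> //; exists Phi.
Qed.

End ScaleExistence.

(** * From a strictly decreasing scale function to continuity at the minimum *)

Section ScaleConverse.
Context {d : measure_display} {Omega : measurableType d} {R : realType}.
Variables (I : set R) (P : R -> probability Omega R) (F : R -> set (set Omega)).
Variables (zeta : Omega -> \bar R) (X : R -> Omega -> R).
Hypothesis ss : standing_setting P I F zeta X.

Local Notation T := (Tminus zeta X).
Local Notation Xc := (Xc zeta X).
Local Notation hit l := [set w | (T l w < zeta w)%E].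
Local Notation laplace := (hit_laplace P zeta X).
Local Notation after_ratio := (after_ratio zeta X).

(* Right continuity reads off [X_T < b] from the rational times just after [T]. *)
Lemma overshoot_measurable a b : measurable (hit a `&` [set w | X (fine (T a w)) w < b]).
Proof.
(* The index [j] is a margin below [b] that turns the strict bound into a closed one, and [k] fixes
   the window [T_a < s < T_a + 1/(k+1)] in which the rational times [s] are tested. *)
have -> : hit a `&` [set w | X (fine (T a w)) w < b] =
  hit a `&` \bigcup_j \bigcup_k \bigcap_s
   (([set w | ((ratr s)%:E <= T a w)%E] `|`
     [set w | (T a w <= (ratr s - k.+1%:R^-1)%:E)%E]) `|`
    [set w | 0 <= ratr s :> R -> (Xc (ratr s) w <= (b - j.+1%:R^-1)%:E)%E]).
  apply/seteqP; split=> w [Tz] h; split=> //=; have [T0 TE _] := Tminus_attained ss Tz;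
    have Tz' : ((fine (T a w))%:E < zeta w)%E by rewrite -TE.
    have h' : 0 < b - X (fine (T a w)) w by rewrite subr_gt0.
    have [j hj] := invSn_lt h'.
    have Xj : X (fine (T a w)) w < b - j.+1%:R^-1 by move: hj; rewrite ltrBrDr addrC -ltrBrDr.
    have [e e0 he] := right_lt ss T0 Tz' Xj.
    have [k hk] := invSn_lt e0.
    exists j => //; exists k => // s _ /=.
    have [sT|Ts] := leP (ratr s)%:E (T a w); first by left; left.
    have [Tk|kT] := leP (T a w) (ratr s - k.+1%:R^-1)%:E; first by left; right.
    right => s0; move: Ts kT; rewrite TE !lte_fin => Ts kT.
    have [||sz Xs] := he (ratr s); [exact: ltW| |].
      by move: kT; rewrite ltrBlDr => /lt_trans; apply; rewrite ltrD2l.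
    by rewrite /Defs.Xc sz lee_fin ltW.
  move: h => [j _ [k _ h]].
  suff : X (fine (T a w)) w <= b - j.+1%:R^-1.
    by move=> /le_lt_trans; apply; rewrite ltrBlDr ltrDl invSn_gt0.
  rewrite leNgt; apply/negP => hX.
  have [e e0 he] := right_gt ss T0 Tz' hX.
  have hlt : fine (T a w) < fine (T a w) + Num.min e k.+1%:R^-1.
    by rewrite ltrDl lt_min e0 invSn_gt0.
  have [s] := rat_in_itvoo hlt; rewrite in_itv /= -ltrBlDl lt_min => /andP[s1 /andP[s2 s3]].
  have [|sz Xs] := he (ratr s) (ltW s1); first by rewrite -ltrBlDl.
  have [[]|] := h s Logic.I.
  - by rewrite /= TE lee_fin leNgt s1.
  - by rewrite /= TE lee_fin lerBrDr -lerBrDl leNgt s3.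
  - move=> /(_ (le_trans T0 (ltW s1))); rewrite /Defs.Xc sz lee_fin leNgt => /negP; exact.
apply: measurableI; first exact: (hit_measurable ss).
have mT := stopping_measurable ss (Tminus_stopping ss a).
apply: bigcupT_measurable => j; apply: bigcupT_measurable => k.
apply: bigcapT_measurable_rat => s; apply: measurableU; first apply: measurableU.
- by rewrite -[X in measurable X]setTI; exact: (emeasurable_fun_c_infty measurableT mT).
- by rewrite -[X in measurable X]setTI; exact: (emeasurable_fun_infty_c measurableT mT).
- have [s0|s0] := leP 0 (ratr s : R).
    rewrite (_ : [set w | _] = [set w | (Xc (ratr s) w <= (b - j.+1%:R^-1)%:E)%E]).
      exact: (F_sub_measurable ss s0 (X_adapted ss s0 (measurable_ereal_le _))).
    by apply/seteqP; split=> w //= h; exact: h.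
  by rewrite (_ : [set w | _] = setT) //; apply/seteqP; split.
Qed.

Lemma identity_S_condP q Phi : 0 < q -> (forall x, I x -> 0 < Phi x) ->
  identity_S P I zeta X q Phi -> condP P I zeta X.
Proof.
move=> q0 Phi0 hS x l Ix Il lx.
apply: lt_le_trans (laplace_le_Pr P zeta X x l (ltW q0)).
by rewrite /hit_laplace hS// lte_fin divr_gt0 ?Phi0.
Qed.

(** Bounds the contribution after [T_a] uniformly over landing points [y <= m]: from above [l] by
    (S) and monotonicity, from [l] or below because the transform is [1]. *)
Lemma laplace_lower_bound q Phi l m y : 0 < q -> (forall x, I x -> 0 < Phi x) ->
  (forall x y, I x -> I y -> x < y -> Phi y < Phi x) ->
  identity_S P I zeta X q Phi -> I l -> I m -> I y -> l <= m -> y <= m ->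
  ((Phi m / Phi l)%:E <= laplace q y l)%E.
Proof.
move=> q0 Phi0 Phidec hS Il Im Iy lm ym.
have mono u v : I u -> I v -> u <= v -> Phi v <= Phi u.
  by move=> Iu Iv; rewrite le_eqVlt => /predU1P[->//|uv]; exact/ltW/Phidec.
have [yl|ly] := leP y l.
  rewrite (laplace_eq1 ss (ltW q0) Iy yl) lee_fin ler_pdivrMr ?Phi0// mul1r.
  exact: mono.
rewrite (_ : laplace q y l = (Phi y / Phi l)%:E); last by apply: hS => //; exact: ltW.
by rewrite lee_fin ler_wpM2r ?invr_ge0 ?(ltW (Phi0 _ _))//; exact: mono.
Qed.

(** With [c = Phi a / Phi l] and [c' = Phi m / Phi l > c], the strong Markov property bounds
    [laplace q x l] below by [c] times [laplace q x a] plus [c' - c] times the discounted mass of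
    the overshoot event. By (S) the first term already equals [laplace q x l], so that mass is zero,
    and so is the probability, the discount being positive. *)
Lemma overshoot_null q Phi l a b x : 0 < q -> (forall x, I x -> 0 < Phi x) ->
  (forall x y, I x -> I y -> x < y -> Phi y < Phi x) ->
  identity_S P I zeta X q Phi -> I l -> I a -> I x -> l < a -> a <= x -> b < a ->
  P x (hit a `&` [set w | X (fine (T a w)) w < b]) = 0%E.
Proof.
move=> q0 Phi0 Phidec hS Il Ia Ix la ax ba.
set B := _ `&` _; have mB : measurable B by exact: overshoot_measurable.
have mH := hit_measurable ss a.
(* The level [b] may lie outside [I]; its maximum with [l] is in [I], still bounds the landing
   points below [b], and stays below [a]. *)
pose m := Num.max b l.
have lm : l <= m by rewrite le_max lexx orbT.
have ma : m < a by rewrite gt_max ba.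
have Im : I m by apply: (I_between ss Il Ia) => //; exact: ltW.
pose c := Phi a / Phi l; pose c' := Phi m / Phi l.
have Pl := Phi0 l Il.
have c0 : 0 <= c by rewrite divr_ge0 ?(ltW (Phi0 _ _)).
have cc' : 0 < c' - c by rewrite subr_gt0 ltr_pM2r ?invr_gt0// Phidec.
pose e w : \bar R := (expR (- q * fine (T a w)))%:E.
have e0 w : (0 <= e w)%E by rewrite lee_fin expR_ge0.
have me : measurable_fun (hit a) e by exact: (expT_measurable ss).
pose W1 w : \bar R := (c%:E + (c' - c)%:E * (\1_B w)%:E)%E.
have i0 w : (0 <= (\1_B w)%:E :> \bar R)%E by rewrite lee_fin.
have mi : measurable_fun (hit a) (fun w => (\1_B w)%:E : \bar R).
  by apply: measurable_funTS; apply/measurable_EFinP; exact: measurable_indic.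
have mW1 : measurable_fun (hit a) W1.
  by apply: emeasurable_funD => //; apply: emeasurable_funM.
have W10 w : hit a w -> (0 <= W1 w)%E.
  by move=> _; apply: adde_ge0; [rewrite lee_fin|apply: mule_ge0 => //; rewrite lee_fin ltW].
have mR : measurable_fun (hit a) (after_ratio q l a).
  by apply: measurable_funTS; exact: (after_ratio_measurable ss).
have R0 w : hit a w -> (0 <= after_ratio q l a w)%E by move=> _; exact: after_ratio_ge0.
have key : (\int[P x]_(w in hit a) (e w * W1 w) <=
    \int[P x]_(w in hit a) (e w * after_ratio q l a w))%E.
  apply: (hit_grid_le ss (ltW q0) mW1 mR W10 R0) => u v.
  rewrite (markov_cell ss) ?(ltW q0) ?(ltW la)//.
  apply: le_lower_integral => w [_ Tz]; first exact: W10.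
  have [T0 TE XT] := Tminus_attained ss Tz.
  have IX : I (X (fine (T a w)) w) by apply: (X_in_I ss) => //; rewrite -TE.
  rewrite /W1 indicE; case: (boolP (w \in B)) => [/set_mem[_ /= Xb]|_].
    rewrite mule1 -EFinD addrC subrK.
    by apply: laplace_lower_bound => //; rewrite le_max (ltW Xb).
  by rewrite mule0 adde0; apply: laplace_lower_bound => //; exact: ltW.
rewrite (laplace_after_ratio P zeta X q x (ltW la)) in key.
have E1 : (\int[P x]_(w in hit a) (e w * W1 w) =
    c%:E * laplace q x a + (c' - c)%:E * \int[P x]_(w in hit a) (e w * (\1_B w)%:E))%E.
  have cE0 : (0 <= c%:E)%E by rewrite lee_fin.
  have ccE0 : (0 <= (c' - c)%:E)%E by rewrite lee_fin ltW.
  have mb : measurable_fun (hit a) (fun w => e w * (\1_B w)%:E)%E by exact: emeasurable_funM.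
  have b0 w : hit a w -> (0 <= e w * (\1_B w)%:E)%E by rewrite mule_ge0.
  have mce : measurable_fun (hit a) (fun w => c%:E * e w)%E by exact: emeasurable_funM.
  have mcb : measurable_fun (hit a) (fun w => (c' - c)%:E * (e w * (\1_B w)%:E))%E.
    exact: emeasurable_funM.
  have ce0 w : hit a w -> (0 <= c%:E * e w)%E by rewrite mule_ge0.
  have cb0 w : hit a w -> (0 <= (c' - c)%:E * (e w * (\1_B w)%:E))%E.
    by move=> Tz; rewrite mule_ge0// b0.
  rewrite -(ge0_integralZl (P x) mH mb b0 ccE0) /hit_laplace /Ex.
  rewrite -(ge0_integralZl (P x) mH me (fun w _ => e0 w) cE0) -ge0_integralD//.
  apply: eq_integral => w _; rewrite /W1 ge0_muleDr//; last exact: mule_ge0.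
  by rewrite muleC [(e w * (_ * _))%E]muleCA.
have xl : l <= x by apply: le_trans ax; exact: ltW.
have E2 : (c%:E * laplace q x a = laplace q x l)%E.
  rewrite (_ : laplace q x a = (Phi x / Phi a)%:E); last exact: hS.
  rewrite (_ : laplace q x l = (Phi x / Phi l)%:E); last exact: hS.
  rewrite -EFinM /c mulrC mulrA divfK// gt_eqF// Phi0//.
have iB0 : (\int[P x]_(w in hit a) (e w * (\1_B w)%:E) = 0)%E.
  apply/eqP; rewrite eq_le integral_ge0 ?andbT//; last by move=> w _; rewrite mule_ge0.
  move: key; rewrite E1 E2 (laplace_fin ss x l (ltW q0)) -[leRHS]adde0 leeD2lE//.
  by rewrite pmule_rle0// lte_fin.
apply: (integral_pos_null mB (f := e)).
- by apply: measurable_funS me => // w [].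
- by move=> w _; rewrite lte_fin expR_gt0.
rewrite -iB0 -[in LHS](setIidr (_ : B `<=` hit a)); last by move=> w [].
rewrite integral_mkcondr; apply: eq_integral => w _.
by rewrite /patch indicE; case: ifP; rewrite ?mule1 ?mule0.
Qed.

(** A level [a] above the infimum of [I] has a comparison level [l < a] in [I], and [X_{T_a} < a] is
    the countable union of the overshoots below [a - 1/(n+1)]. *)
Lemma statement_iv_cont_at_min :
  statement_iv P I zeta X -> cont_at_min P I zeta X /\ condP P I zeta X.
Proof.
move=> [q [q0 [Phi [Phi0 Phidec hS]]]]; split; last exact: identity_S_condP hS.
move=> a x Ia Ix ax [l [Il la]].
have null n : (P x).-negligible (hit a `&` [set w | X (fine (T a w)) w < a - n.+1%:R^-1]).
  apply/negligibleP; first exact: overshoot_measurable.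
  by apply: (overshoot_null q0 Phi0 Phidec hS Il Ia Ix la ax); rewrite ltrBlDr ltrDl invSn_gt0.
apply: negligibleS (negligible_bigcup null) => w /= [Tz Xa].
have [T0 TE XT] := Tminus_attained ss Tz.
have Xlt : 0 < a - X (fine (T a w)) w.
  by rewrite subr_gt0 lt_neqAle XT andbT; exact/eqP.
have [n hn] := invSn_lt Xlt.
by exists n => //; split=> //=; rewrite ltrBrDr addrC -ltrBrDr.
Qed.

End ScaleConverse.

Theorem mainTheorem1 (d : measure_display) (Omega : measurableType d) (R : realType)
  (I : set R) (P : R -> probability Omega R) (F : R -> set (set Omega))
  (zeta : Omega -> \bar R) (X : R -> Omega -> R) :
  standing_setting P I F zeta X ->
  [<-> no_negative_jumps P I zeta X /\ condP P I zeta X;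
       inf_continuous P I zeta X /\ condP P I zeta X;
       statement_iii P I zeta X;
       statement_iv P I zeta X;
       cont_at_min P I zeta X /\ condP P I zeta X] /\
  [<-> no_negative_jumps P I zeta X;
       inf_continuous P I zeta X;
       cont_at_min P I zeta X].
Proof.
move=> ss.
have ij := @no_negative_jumps_inf_continuous _ _ _ _ _ _ _ _ ss.
have jv := inf_continuous_cont_at_min ss.
have vi := cont_at_min_no_negative_jumps ss.
split; last by tfae.
tfae.
- by move=> [/ij].
- by move=> [/jv hc hP]; exact: (cont_at_min_statement_iii ss).
- exact: statement_iii_iv.
- exact: (statement_iv_cont_at_min ss).
- by move=> [/vi].
Qed.
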